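(* Let $H\in C^2(\mathbb{R}^d)$ be uniformly convex and let $F(p):=\sqrt{D^2H(p)}$. Suppose that $d=1$ or that $H$ is quadratic. Let $C>0$. (a) Suppose $u\in \mathrm{BUC}(\mathbb{R}^d\times[0,\infty))$ is a viscosity solution of $u_t=H(Du)$ in $\mathbb{R}^d\times(0,\infty)$ and $$-F(Du(\cdot,0))\,D^2u(\cdot,0)\,F(Du(\cdot,0))\ge -C\,I\quad\text{in }\mathbb{R}^d$$ in the viscosity sense. Then, for all $t>0$, in the viscosity sense, $$-F(Du(\cdot,t))\,D^2u(\cdot,t)\,F(Du(\cdot,t))\ge -\frac{C}{(1-Ct)_+}\,I\quad\text{in }\mathbb{R}^d.$$ (b) Suppose $u\in \mathrm{BUC}(\mathbb{R}^d\times[0,\infty))$ is a viscosity solution of $u_t=-H(Du)$ in $\mathbb{R}^d\times(0,\infty)$ and $$-F(Du(\cdot,0))\,D^2u(\cdot,0)\,F(Du(\cdot,0))\le C\,I\quad\text{in }\mathbb{R}^d$$ in the viscosity sense. Then, for all $t>0$, in the viscosity sense, $$-F(Du(\cdot,t))\,D^2u(\cdot,t)\,F(Du(\cdot,t))\le \frac{C}{(1-Ct)_+}\,I\quad\text{in }\mathbb{R}^d.$$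
   Context: $\mathrm{BUC}(X)$ is the set of bounded uniformly continuous real functions on $X$. $I$ is the $d\times d$ identity matrix, and matrix inequalities are in the sense of symmetric matrices. ''$H\in C^2(\mathbb{R}^d)$ is uniformly convex'' means that there exist $\Theta,\theta>0$ such that $\theta I\le D^2H(p)\le\Theta I$ for all $p\in\mathbb{R}^d$. $F(p)=\sqrt{D^2H(p)}$ is the positive definite symmetric square root. $H$ is called quadratic if there exists a symmetric matrix $A$ with $\theta I\le A\le\Theta I$ for some $\theta,\Theta>0$ such that $H(p)=(Ap,p)$ for all $p$. Solutions of $u_t=\pm H(Du)$ are Crandall-Lions viscosity solutions. For a continuous $v:\mathbb{R}^d\to\mathbb{R}$ and a constant $K$, the inequality $-F(Dv)D^2vF(Dv)\le K I$ (resp. $\ge -KI$) holds in the viscosity sense if, for every smooth $\phi$ and every maximum (resp. minimum) point $x_0$ of $v-\phi$, $-F(D\phi(x_0))D^2\phi(x_0)F(D\phi(x_0))\le K I$ (resp. $\ge -KI$). $s_+=\max(s,0)$, and when $(1-Ct)_+=0$ the quotient $\frac{C}{(1-Ct)_+}$ is $+\infty$, so the inequality is void. *)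

(* Defs.v *)
From HB Require Import structures.
From mathcomp Require Import all_boot all_order all_algebra.
From mathcomp Require Import all_classical all_reals all_analysis.

Set Implicit Arguments.
Unset Strict Implicit.
Unset Printing Implicit Defensive.

Import Order.TTheory GRing.Theory Num.Theory.
Import numFieldNormedType.Exports.

Local Open Scope classical_set_scope.
Local Open Scope ring_scope.

(* Points and vectors of R^d are row vectors.  The norm of 'rV[R]_d is the sup
   norm; only the topology and the uniform structure it induces are used. *)

(* C^k on a set D, meant for D open in a finite-dimensional V: the directional
   derivatives of f up to order k exist and are continuous at the points of D.
   Because D is open, f is allowed arbitrary values outside D. *)
Fixpoint Ck_on (R : realType) (V : normedModType R) (D : set V) (k : nat)
    (f : V -> R) : Prop :=
  (forall x, D x -> {for x, continuous f}) /\
  if k is k'.+1 then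
    forall v : V, (forall x, D x -> derivable f x v) /\
                  Ck_on D k' (fun x => 'D_v f x)
  else True.

Definition smooth (R : realType) (V : normedModType R) (f : V -> R) : Prop :=
  forall k, Ck_on setT k f.

Definition grad (R : realType) (d : nat) (f : 'rV[R]_d -> R) (x : 'rV[R]_d) :
  'rV[R]_d := \row_j 'D_(delta_mx 0 j) f x.

Definition hess (R : realType) (d : nat) (f : 'rV[R]_d -> R) (x : 'rV[R]_d) :
  'M[R]_d :=
  \matrix_(i, j) 'D_(delta_mx 0 i) (fun y => 'D_(delta_mx 0 j) f y) x.

Definition qform (R : realType) (d : nat) (A : 'M[R]_d) (x : 'rV[R]_d) : R :=
  (x *m A *m x^T) 0 0.

(* The order on symmetric matrices; it is only applied to such matrices. *)
Definition mxle (R : realType) (d : nat) (A B : 'M[R]_d) : Prop :=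
  forall x : 'rV[R]_d, qform A x <= qform B x.

(* The positive definite symmetric square root; a junk value when A is not
   symmetric positive definite. *)
Definition sqrtmx (R : realType) (d : nat) (A : 'M[R]_d) : 'M[R]_d :=
  xget 0 [set S : 'M[R]_d |
    [/\ S^T = S, (forall x : 'rV[R]_d, x != 0 -> 0 < qform S x)
      & S *m S = A]].

Definition uniformly_convex (R : realType) (d : nat) (H : 'rV[R]_d -> R) :
  Prop :=
  exists theta Theta : R, [/\ 0 < theta, 0 < Theta &
    forall p, mxle theta%:M (hess H p) /\ mxle (hess H p) Theta%:M].

Definition quadratic (R : realType) (d : nat) (H : 'rV[R]_d -> R) : Prop :=
  exists A : 'M[R]_d,
    [/\ A^T = A,
        exists theta Theta : R,
          [/\ 0 < theta, 0 < Theta, mxle theta%:M A & mxle A Theta%:M]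
      & forall p, H p = qform A p].

(* Space-time R^d x [0, oo[ and its interior.  Functions of (x, t) are total on
   R^d x R; their values at negative times are never constrained nor used. *)
Definition closed_half (R : realType) (d : nat) : set ('rV[R]_d * R) :=
  [set z | 0 <= z.2].

Definition open_half (R : realType) (d : nat) : set ('rV[R]_d * R) :=
  [set z | 0 < z.2].

Definition BUC (R : realType) (V : normedModType R) (D : set V) (u : V -> R) :
  Prop :=
  [bounded u z | z in D] /\ unif_continuous (u : subspace D -> R).

Definition time_deriv (R : realType) (d : nat) (phi : 'rV[R]_d * R -> R)
  (z : 'rV[R]_d * R) : R := derive1 (fun t => phi (z.1, t)) z.2.

Definition space_grad (R : realType) (d : nat) (phi : 'rV[R]_d * R -> R)
  (z : 'rV[R]_d * R) : 'rV[R]_d := grad (fun x => phi (x, z.2)) z.1.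

(* Viscosity sub- and supersolutions of u_t = G(Du) in R^d x ]0, oo[. *)
Definition viscosity_subsolution (R : realType) (d : nat) (G : 'rV[R]_d -> R)
  (u : 'rV[R]_d * R -> R) : Prop :=
  forall (phi : 'rV[R]_d * R -> R) (z : 'rV[R]_d * R),
    Ck_on (@open_half R d) 1 phi -> 0 < z.2 ->
    (\forall w \near z, u w - phi w <= u z - phi z) ->
    time_deriv phi z <= G (space_grad phi z).

Definition viscosity_supersolution (R : realType) (d : nat)
  (G : 'rV[R]_d -> R) (u : 'rV[R]_d * R -> R) : Prop :=
  forall (phi : 'rV[R]_d * R -> R) (z : 'rV[R]_d * R),
    Ck_on (@open_half R d) 1 phi -> 0 < z.2 ->
    (\forall w \near z, u z - phi z <= u w - phi w) ->
    G (space_grad phi z) <= time_deriv phi z.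

Definition viscosity_solution (R : realType) (d : nat) (G : 'rV[R]_d -> R)
  (u : 'rV[R]_d * R -> R) : Prop :=
  viscosity_subsolution G u /\ viscosity_supersolution G u.

(* - F(Dv) D^2v F(Dv) <= K I in the viscosity sense. *)
Definition viscosity_mxle (R : realType) (d : nat) (F : 'rV[R]_d -> 'M[R]_d)
  (v : 'rV[R]_d -> R) (K : R) : Prop :=
  forall (phi : 'rV[R]_d -> R) (x0 : 'rV[R]_d),
    smooth phi -> (forall x, v x - phi x <= v x0 - phi x0) ->
    mxle (- (F (grad phi x0) *m hess phi x0 *m F (grad phi x0))) K%:M.

(* - F(Dv) D^2v F(Dv) >= - K I in the viscosity sense (note the sign of K). *)
Definition viscosity_mxge (R : realType) (d : nat) (F : 'rV[R]_d -> 'M[R]_d)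
  (v : 'rV[R]_d -> R) (K : R) : Prop :=
  forall (phi : 'rV[R]_d -> R) (x0 : 'rV[R]_d),
    smooth phi -> (forall x, v x0 - phi x0 <= v x - phi x) ->
    mxle (- K)%:M (- (F (grad phi x0) *m hess phi x0 *m F (grad phi x0))).

(* Main.v *)
Require Import Defs.
From HB Require Import structures.
From mathcomp Require Import all_boot all_order all_algebra.
From mathcomp Require Import all_classical all_reals all_analysis.
From mathcomp Require Import ring lra.

Set Implicit Arguments.
Unset Strict Implicit.
Unset Printing Implicit Defensive.

Import Order.TTheory GRing.Theory Num.Theory.
Import numFieldNormedType.Exports.

Local Open Scope classical_set_scope.
Local Open Scope ring_scope.

(** Replacing [u] by [- u] and [H] by [p |-> H (- p)] exchanges the two halves of
    the statement, so let [u] solve [u_t = H (Du)], and let the bound be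
    [F (Du) D^2 u F (Du) <= C] at time 0. Let [L] be the Legendre transform of
    [H]. The proof rests on the Hopf-Lax formula
      [u (x, t) = sup_y (u (y, 0) - t L ((y - x) / t))],
    which reduces the equation to a sup-convolution ([solution_sup_convolution]).
    It follows from the comparison principle ([comparison], by doubling of
    variables): each function [u (x + t q, 0) - t L q] is a subsolution, and
    their supremum over [q] is a supersolution, by dynamic programming.

    If [H] is quadratic, [F] is a constant matrix, and the change of variables
    given by [F] turns [L] into half the squared Euclidean norm. The initial
    bound means that, in the new variables, [u (x, 0) - C |x|^2 / 2] is concave
    ([semiconcave_touch]), and the sup-convolution turns the constant [C] into
    [C / (1 - C t)], by completing a square ([semiconcave_sup_convolution]).

    If [d = 1], the place of the paraboloids is taken by the solutions
    [v = L (C (x - a)) / C + c] of [H''(v') v'' = C], called cones below. The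
    initial bound implies that, on an interval, [u (x, 0)] stays above any cone
    that it exceeds at both ends ([touch_above_cones]). By convexity of [L] the
    flow maps the cones of parameter [C] to those of parameter
    [K = C / (1 - C t)], since [1 / K + t = 1 / C] ([cone_evolution]). The order
    of the line makes the comparison with cones survive the sup-convolution
    ([above_cones_evolution]), and this comparison at time [t] gives back the
    viscosity inequality ([touch_evolution]). *)

(** * Directional derivatives, Taylor expansions and smooth functions *)

Lemma near_normP (R : realType) (V : normedModType R) (z : V) (P : V -> Prop) :
  (\forall w \near z, P w) <->
  exists2 r : R, 0 < r & forall w, `|w - z| < r -> P w.
Proof.
split=> [/nbhs_normP[r r0 Pr]|[r r0 Pr]].
  exists r => // w wz; apply: Pr; rewrite /= distrC; exact: wz.
by apply/nbhs_normP; exists r => // w /=; rewrite distrC => /Pr.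
Qed.

Lemma continuous_atP (R : realType) (V : normedModType R) (f : V -> R) (z : V) :
  {for z, continuous f} <->
  forall e, 0 < e -> exists2 r : R, 0 < r &
    forall w, `|w - z| < r -> `|f w - f z| < e.
Proof.
split=> [/cvgrPdist_lt cf e e0|cf].
  have /near_normP[r r0 Hr] := cf e e0.
  by exists r => // w /Hr; rewrite distrC.
apply/cvgrPdist_lt => e e0; have [r r0 Hr] := cf e e0.
by apply/near_normP; exists r => // w /Hr; rewrite distrC.
Qed.

Lemma derivable_expand (R : realType) (V : normedModType R) (f : V -> R)
    (x v : V) : derivable f x v ->
  forall e, 0 < e -> exists2 r : R, 0 < r & forall h, `|h| < r ->
    `|f (x + h *: v) - f x - h * 'D_v f x| <= e * `|h|.
Proof.
move=> df e e0; have /cvgrPdist_lt/(_ e e0) := df.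
rewrite -[lim _]/('D_v f x) => /nbhs_normP[r r0 Hr]; exists r => // h hr.
have [->|h0] := eqVneq h 0.
  by rewrite scale0r addr0 mul0r subr0 subrr normr0 mulr0.
have := Hr h; rewrite /= sub0r normrN => /(_ hr h0).
rewrite /= [h *: v + x]addrC /GRing.scale/= => /ltW H1.
have -> : f (x + h *: v) - f x - h * 'D_v f x =
  - (h * ('D_v f x - h^-1 * (f (x + h *: v) - f x))).
  by field.
by rewrite normrN normrM mulrC ler_wpM2r.
Qed.

Lemma deriveZv (R : realType) (V : normedModType R) (f : V -> R) (x v : V)
    (c : R) : derivable f x v -> derivable f x (c *: v) ->
  'D_(c *: v) f x = c * 'D_v f x.
Proof.
move=> dv dcv; apply/eqP; rewrite -subr_eq0 -normr_le0; apply/ler_addgt0Pr => e e0.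
rewrite add0r.
have c1 : 0 < 1 + `|c| by rewrite ltr_pwDl.
have e' : 0 < e / (1 + `|c|) by rewrite divr_gt0.
have [r r0 Hr] := derivable_expand dv e'.
have [s s0 Hs] := derivable_expand dcv e'.
pose h := Num.min (s / 2) (r / 2 / (1 + `|c|)).
have h0 : 0 < h by rewrite lt_min !divr_gt0.
have hn : `|h| = h by rewrite gtr0_norm.
have hs : `|h| < s.
  rewrite hn (@le_lt_trans _ _ (s / 2)) ?ge_min ?lexx//.
  by rewrite ltr_pdivrMr// ltr_pMr// ltr1n.
have hr : `|h * c| < r.
  rewrite normrM hn (@le_lt_trans _ _ (r / 2 / (1 + `|c|) * `|c|))//.
    by rewrite ler_wpM2r// ge_min lexx orbT.
  rewrite -mulrA (@le_lt_trans _ _ (r / 2))//.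
    by rewrite ler_piMr ?divr_ge0 ?(ltW r0)// ler_pdivrMl// mulr1 lerDr.
  by rewrite ltr_pdivrMr// ltr_pMr// ltr1n.
have := Hs _ hs; have := Hr _ hr; rewrite scalerA.
set X := f _ - f x => A B.
rewrite -(ler_pM2l h0) -{1}hn -normrM.
have -> : h * ('D_(c *: v) f x - c * 'D_v f x) =
   (X - h * c * 'D_v f x) - (X - h * 'D_(c *: v) f x) by ring.
rewrite (le_trans (ler_normB _ _))// (le_trans (lerD A B))//.
rewrite normrM hn.
rewrite le_eqVlt; apply/orP; left; apply/eqP; field.
by rewrite gt_eqF.
Qed.

Lemma line_is_derive (R : realType) (V : normedModType R) (f : V -> R)
    (x v : V) (s : R) : derivable f (x + s *: v) v ->
  is_derive s (1 : R) (fun s => f (x + s *: v)) ('D_v f (x + s *: v)).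
Proof.
rewrite /derivable => df.
have E : (fun h : R => h^-1 *: (((fun s => f (x + s *: v)) \o shift s) (h *: 1) -
            f (x + s *: v))) =
  (fun h : R => h^-1 *: ((f \o shift (x + s *: v)) (h *: v) - f (x + s *: v))).
  apply/funext => h /=.
  have -> : h *: (1 : R) = h by exact: mulr1.
  by rewrite scalerDl addrCA.
by split; [rewrite /derivable E|rewrite /derive E].
Qed.

Lemma MVT_closed (R : realType) (f df : R -> R) (a b : R) : a <= b ->
  (forall s : R, a <= s <= b -> is_derive s (1 : R) f (df s)) ->
  exists2 c, a <= c <= b & f b - f a = df c * (b - a).
Proof.
move=> ab d.
have cf : {within `[a, b], continuous f}.
  by apply: derivable_within_continuous => s0; rewrite in_itv/= => /d [].
have df' (s : R) : s \in `]a, b[%R -> is_derive s (1 : R) f (df s).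
  by rewrite in_itv/= => /andP[/ltW sa /ltW sb]; apply: d; rewrite sa.
have [c] := MVT_segment ab df' cf.
by rewrite in_itv/= => c01 ->; exists c.
Qed.

Lemma MVT_line (R : realType) (V : normedModType R) (f : V -> R) (x v : V) :
  (forall s : R, 0 <= s <= 1 -> derivable f (x + s *: v) v) ->
  exists2 s : R, 0 <= s <= 1 & f (x + v) - f x = 'D_v f (x + s *: v).
Proof.
move=> df.
have [s s01|c c01] := @MVT_closed R (fun s => f (x + s *: v))
   (fun s => 'D_v f (x + s *: v)) 0 1 ler01 _.
  by apply: line_is_derive; exact: df.
rewrite scale1r scale0r addr0 subr0 mulr1 => E; exists c => //.
Qed.

Section C1.
Context {R : realType} {V : normedModType R}.
Implicit Types (f : V -> R) (D : set V).

(** Directional derivatives need not be additive in the direction. The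
    increment along [v] starts from the moving point [x + h w], so it is
    compared with [D_v f x] through the continuity of [D_v f] at [x]. *)
Lemma derive_addv f D x v w : open D -> Ck_on D 1 f -> D x ->
  'D_(v + w) f x = 'D_v f x + 'D_w f x.
Proof.
move=> oD [cf Df] Dx; apply/eqP; rewrite -subr_eq0 -normr_le0.
apply/ler_addgt0Pr => e e0; rewrite add0r.
have e3 : 0 < e / 3 by rewrite divr_gt0.
have [d_v [cDv _]] := Df v; have [d_w _] := Df w; have [d_vw _] := Df (v + w).
have [r1 r10 H1] := (@continuous_atP R V _ x).1 (cDv x Dx) _ e3.
have [r2 r20 H2] := (near_normP x D).1 (open_nbhs_nbhs (conj oD Dx)).
have [r3 r30 H3] := derivable_expand (d_w x Dx) e3.
have [r4 r40 H4] := derivable_expand (d_vw x Dx) e3.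
pose N := 1 + `|v| + `|w|; have N0 : 0 < N by rewrite !ltr_wpDr.
pose r := Num.min (Num.min (r1 / N) (r2 / N)) (Num.min r3 r4).
have r0 : 0 < r by rewrite !lt_min r30 r40 !divr_gt0.
pose h := r / 2; have h0 : 0 < h by rewrite divr_gt0.
have hn : `|h| = h by rewrite gtr0_norm.
have hr : h < r by rewrite ltr_pdivrMr// ltr_pMr// ltr1n.
have near_x (s : R) : 0 <= s <= 1 ->
    `|x + h *: w + s *: (h *: v) - x| < Num.min r1 r2.
  move=> /andP[s0 s1].
  have -> : x + h *: w + s *: (h *: v) - x = h *: (w + s *: v).
    rewrite scalerDr addrC 2!addrA addNr add0r; congr (_ + _).
    by rewrite !scalerA mulrC.
  have le : `|w + s *: v| <= N.
    rewrite (le_trans (ler_normD _ _))// normrZ ger0_norm//.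
    have : s * `|v| <= `|v| by rewrite ler_piMl.
    rewrite /N; lra.
  rewrite normrZ hn (@le_lt_trans _ _ (h * N))//; first by rewrite ler_wpM2l// ltW.
  rewrite -ltr_pdivlMr// (lt_le_trans hr)// ler_pdivlMr// le_min.
  rewrite -!ler_pdivlMr//.
  by rewrite /r !ge_min !lexx /= orbT.
have dline (s : R) : 0 <= s <= 1 -> derivable f (x + h *: w + s *: (h *: v)) (h *: v).
  move=> s01; have [d _] := Df (h *: v); apply: d; apply: H2.
  by apply: lt_le_trans (near_x _ s01) _; rewrite ge_min lexx orbT.
have [s s01] := MVT_line dline.
have H1' := near_x _ s01.
have Dy : D (x + h *: w + s *: (h *: v)).
  by apply: H2; apply: lt_le_trans H1' _; rewrite ge_min lexx orbT.
rewrite deriveZv; [|exact: d_v|by have [d _] := Df (h *: v); apply: d].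
set y := x + h *: w + s *: (h *: v) => Ev.
have Hy : `|'D_v f y - 'D_v f x| < e / 3.
  by apply: H1; apply: lt_le_trans H1' _; rewrite ge_min lexx.
have hr3 : `|h| < r3 by rewrite hn (lt_le_trans hr)// /r !ge_min lexx !orbT.
have hr4 : `|h| < r4 by rewrite hn (lt_le_trans hr)// /r !ge_min lexx !orbT.
have B := H3 h hr3; have A := H4 h hr4.
rewrite hn in A B.
have Ex : x + h *: w + h *: v = x + h *: (v + w).
  by rewrite scalerDr -addrA [h *: w + _]addrC.
rewrite Ex in Ev.
rewrite -(ler_pM2l h0) -{1}hn -normrM.
have -> : h * ('D_(v + w) f x - ('D_v f x + 'D_w f x)) =
   - (f (x + h *: (v + w)) - f x - h * 'D_(v + w) f x)
   + (f (x + h *: w) - f x - h * 'D_w f x) + h * ('D_v f y - 'D_v f x).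
  rewrite [h * ('D_v f y - _)]mulrBr -Ev; ring.
rewrite (le_trans (ler_normD _ _))// (le_trans (lerD (ler_normD _ _) (lexx _)))//.
rewrite normrN (le_trans (lerD (lerD A B) (lexx _)))//.
rewrite normrM hn.
have : h * `|'D_v f y - 'D_v f x| <= h * (e / 3) by rewrite ler_wpM2l// ltW.
lra.
Qed.

Lemma deriveZ_C1 f D x v (c : R) : Ck_on D 1 f -> D x ->
  'D_(c *: v) f x = c * 'D_v f x.
Proof.
move=> [_ Df] Dx; apply: deriveZv.
  by have [d _] := Df v; apply: d.
by have [d _] := Df (c *: v); apply: d.
Qed.

Lemma derive_sumv f D x n (v : 'I_n -> V) (c : 'I_n -> R) :
  open D -> Ck_on D 1 f -> D x ->
  'D_(\sum_i c i *: v i) f x = \sum_i c i * 'D_(v i) f x.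
Proof.
move=> oD Cf Dx; elim/big_ind2: _ => [|a p b q Ea Eb|i _].
- exact: derive0.
- by rewrite (derive_addv _ _ oD Cf Dx) Ea Eb.
- exact: deriveZ_C1 Cf Dx.
Qed.

Lemma Ck_on_C1 D k f : Ck_on D k.+1 f -> Ck_on D 1 f.
Proof.
move=> [cf Df]; split=> // v; have [dv Cv] := Df v; split=> //.
by case: k Cv {Df} => [|k] [].
Qed.

Lemma Ck_on_derive D k f v : Ck_on D k.+1 f -> Ck_on D k ('D_v f).
Proof. by move=> [_ Df]; have [] := Df v. Qed.

Lemma Ck_on_derivable D k f x v : Ck_on D k.+1 f -> D x -> derivable f x v.
Proof. by move=> [_ Df] Dx; have [d _] := Df v; exact: d. Qed.

Lemma Ck_on_sub D E k f : E `<=` D -> Ck_on D k f -> Ck_on E k f.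
Proof.
move=> ED; elim: k f => [|k IH] f [cf Df]; split=> //; try by move=> x /ED/cf.
by move=> v; have [d C] := Df v; split; [move=> x /ED/d|exact: IH].
Qed.

(** The mean value theorem is applied to [f] minus a parabola along the
    segment, and then to the derivative of that difference. *)
Lemma taylor2_ge f x v (m : R) : Ck_on setT 2 f ->
  (forall s : R, 0 <= s <= 1 -> m <= 'D_v ('D_v f) (x + s *: v)) ->
  f x + 'D_v f x + m / 2 <= f (x + v).
Proof.
move=> Cf Hm.
have C1f : Ck_on setT 1 ('D_v f) by exact: Ck_on_derive.
have ds (s : R) : is_derive s (1 : R) (fun s => f (x + s *: v))
    ('D_v f (x + s *: v)).
  by apply: line_is_derive; exact: (Ck_on_derivable Cf).
have ds1 (s : R) : is_derive s (1 : R) (fun s => 'D_v f (x + s *: v))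
    ('D_v ('D_v f) (x + s *: v)).
  by apply: line_is_derive; exact: (Ck_on_derivable C1f).
pose k (s : R) := f (x + s *: v) - (m / 2 * (s * s) + 'D_v f x * s).
pose k' (s : R) := 'D_v f (x + s *: v) - (m * s + 'D_v f x).
have dk (s : R) : is_derive s (1 : R) k (k' s).
  have -> : k = (fun s : R => f (x + s *: v)) -
      ((m / 2) \*: ((@id R) * (@id R)) + ('D_v f x) \*: (@id R)) by [].
  have did := @is_derive_id R R s 1.
  have dB := is_deriveB (ds s)
    (is_deriveD (is_deriveZ (m / 2) (is_deriveM did did)) (is_deriveZ ('D_v f x) did)).
  apply: is_derive_eq dB _.
  by rewrite /k' /GRing.scale /=; field.
have [c c01] := @MVT_closed R k k' 0 1 ler01 (fun s _ => dk s).
rewrite {1 2}/k scale1r scale0r addr0 subr0 !mulr0 !mulr1 addr0 subr0 => E.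
suff k'0 : 0 <= k' c by move: k'0; rewrite -E; lra.
rewrite /k' subr_ge0.
have c0 : 0 <= c by move: c01 => /andP[].
have [b bc] := @MVT_closed R (fun s => 'D_v f (x + s *: v))
   (fun s => 'D_v ('D_v f) (x + s *: v)) 0 c c0 (fun s _ => ds1 s).
rewrite scale0r addr0 subr0 => E2.
rewrite -lerBrDr E2 ler_wpM2r//; apply: Hm.
by move: bc c01 => /andP[-> bc] /andP[_ c1]; exact: le_trans c1.
Qed.

End C1.

Section Smooth.
Context {R : realType} {V : normedModType R}.
Implicit Types (f g : V -> R).

(** Reduces the derivative of a polynomial to an algebraic identity with a
    quadratic remainder. *)
Lemma is_derive_expand f x v (c M : R) :
  (forall h, `|h| <= 1 -> `|f (x + h *: v) - f x - h * c| <= M * h ^+ 2) ->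
  is_derive x v f c.
Proof.
move=> Hf.
suff Hl : (fun h => h^-1 *: ((f \o shift x) (h *: v) - f x)) @ 0^' --> c.
  by split; [apply/cvg_ex; exists c|exact: cvg_lim Hl].
apply/cvgrPdist_le => e e0.
have M0 : 0 < 1 + `|M| by rewrite ltr_pwDl.
apply/nbhs_normP; exists (Num.min 1 (e / (1 + `|M|))).
  by rewrite /= lt_min ltr01 divr_gt0.
move=> h; rewrite /= sub0r normrN lt_min => /andP[h1 he] h0.
have -> : c - h^-1 *: (f (h *: v + x) - f x) =
   - h^-1 * (f (x + h *: v) - f x - h * c).
  by rewrite [x + _]addrC /GRing.scale/=; field.
rewrite normrM normrN normfV ler_pdivrMl ?normr_gt0//.
rewrite (le_trans (Hf _ (ltW h1)))// -real_normK ?num_real//.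
have : M <= `|M| by exact: ler_norm.
move: he; rewrite ltr_pdivlMr//; have := normr_ge0 h; have := normr_ge0 M.
nra.
Qed.

Lemma smooth_affine f (l : V -> R) : continuous f ->
  (forall x v (h : R), f (x + h *: v) = f x + h * l v) -> smooth f.
Proof.
move=> cf fl.
have dfl x v : is_derive x v f (l v).
  apply: (is_derive_expand (M := 0)) => h _.
  by rewrite fl (_ : _ - _ - _ = 0) ?normr0 ?mul0r//; ring.
case=> [|k]; first by split=> // x _; exact: cf.
split=> [x _|v]; first exact: cf.
split=> [x _|]; first by case: (dfl x v).
have -> : (fun x => 'D_v f x) = cst (l v).
  by apply/funext => x; rewrite derive_val.
elim: k (l v) => [|k IH] c; first by split=> // x _; exact: cst_continuous.
split=> [x _|]; first exact: cst_continuous.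
move=> w; split=> [x _|]; first exact: derivable_cst.
have -> : (fun x => 'D_w (cst c) x) = cst 0.
  by apply/funext => x; rewrite derive_cst.
exact: IH.
Qed.

Lemma smooth_cst (c : R) : smooth (cst c : V -> R).
Proof.
apply: (@smooth_affine _ (cst 0)) => [|x v h]; first exact: cst_continuous.
by rewrite mulr0 addr0.
Qed.

Lemma Ck_add k f g : Ck_on setT k f -> Ck_on setT k g ->
  Ck_on setT k (fun x => f x + g x).
Proof.
elim: k f g => [|k IH] f g [cf df] [cg dg].
  by split=> // x _; apply: continuousD; [exact: cf|exact: cg].
split=> [x _|v]; first by apply: continuousD; [exact: cf|exact: cg].
have [d1 c1] := df v; have [d2 c2] := dg v.
split=> [x _|]; first by apply: derivableD; [exact: d1|exact: d2].
have -> : (fun x => 'D_v (fun x => f x + g x) x) =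
  (fun x => 'D_v f x + 'D_v g x).
  by apply/funext => x; apply: deriveD; [exact: d1|exact: d2].
exact: IH.
Qed.

Lemma Ck_weak k f : Ck_on setT k.+1 f -> Ck_on setT k f.
Proof.
elim: k f => [|k IH] f [cf df]; split=> //.
by move=> v; have [d1 c1] := df v; split=> //; exact: IH.
Qed.

Lemma Ck_mul k f g : Ck_on setT k f -> Ck_on setT k g ->
  Ck_on setT k (fun x => f x * g x).
Proof.
elim: k f g => [|k IH] f g Cf Cg; have [cf df] := Cf; have [cg dg] := Cg.
  by split=> // x _; apply: continuousM; [exact: cf|exact: cg].
split=> [x _|v]; first by apply: continuousM; [exact: cf|exact: cg].
have [d1 c1] := df v; have [d2 c2] := dg v.
split=> [x _|]; first by apply: derivableM; [exact: d1|exact: d2].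
have -> : (fun x => 'D_v (fun x => f x * g x) x) =
  (fun x => f x * 'D_v g x + g x * 'D_v f x).
  by apply/funext => x; apply: deriveM; [exact: d1|exact: d2].
by apply: Ck_add; apply: IH => //; apply: Ck_weak.
Qed.

Lemma smooth_add f g : smooth f -> smooth g -> smooth (fun x => f x + g x).
Proof. by move=> sf sg k; apply: Ck_add. Qed.

Lemma smooth_mul f g : smooth f -> smooth g -> smooth (fun x => f x * g x).
Proof. by move=> sf sg k; apply: Ck_mul. Qed.

Lemma smooth_sum n (f : 'I_n -> V -> R) : (forall i, smooth (f i)) ->
  smooth (fun x => \sum_i f i x).
Proof.
elim: n f => [|n IH] f sf.
  rewrite (_ : (fun _ => _) = cst 0); first exact: smooth_cst.
  by apply/funext => x; rewrite big_ord0.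
rewrite (_ : (fun _ => _) =
  (fun x => \sum_(i < n) f (widen_ord (leqnSn n) i) x + f ord_max x)).
  by apply: smooth_add => //; apply: IH.
by apply/funext => x; rewrite big_ord_recr.
Qed.

End Smooth.

Lemma Ck_continuous (R : realType) (D : normedModType R) k (f : D -> R) :
  Ck_on setT k f -> continuous f.
Proof. by case: k => [|k] [cf _] x; exact: cf. Qed.

(** The constant [de] absorbs the oscillation of the second derivative near
    [x]. *)
Lemma taylor2_local (R : realType) (V : normedModType R) (f : V -> R) x v
    (de : R) : Ck_on setT 2 f -> 0 < de ->
  exists2 r : R, 0 < r & forall h, `|h| < r ->
    f x + h * 'D_v f x + h ^+ 2 / 2 * ('D_v ('D_v f) x - de) <= f (x + h *: v).
Proof.
move=> Cf de0; have C1 := Ck_on_C1 Cf.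
have C1' : Ck_on setT 1 ('D_v f) by exact: Ck_on_derive.
have c2 : continuous ('D_v ('D_v f)).
  by apply: (@Ck_continuous _ _ 0); exact: Ck_on_derive.
have [r r0 Hr] := (continuous_atP _ _).1 (c2 x) _ de0.
have N0 : 0 < 1 + `|v| by rewrite ltr_pwDl.
exists (r / (1 + `|v|)); first by rewrite divr_gt0.
move=> h; rewrite ltr_pdivlMr// => hr.
have D1 y : 'D_(h *: v) f y = h * 'D_v f y by exact: deriveZ_C1 C1 _.
have D2 y : 'D_(h *: v) ('D_(h *: v) f) y = h ^+ 2 * 'D_v ('D_v f) y.
  have -> : 'D_(h *: v) f = h \*: 'D_v f by apply/funext => w; exact: D1.
  rewrite deriveZ; last exact: (Ck_on_derivable C1').
  by rewrite (deriveZ_C1 _ _ C1')// /GRing.scale/= mulrA.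
have T (s : R) : 0 <= s <= 1 -> h ^+ 2 * ('D_v ('D_v f) x - de) <=
    'D_(h *: v) ('D_(h *: v) f) (x + s *: (h *: v)).
  move=> /andP[s0 s1]; rewrite D2 ler_wpM2l ?sqr_ge0//.
  have := Hr (x + s *: (h *: v)); rewrite [x + _]addrC addrK !normrZ (ger0_norm s0).
  have -> : s * (`|h| * `|v|) < r.
    apply: le_lt_trans hr; rewrite mulrDr mulr1.
    have : s * (`|h| * `|v|) <= `|h| * `|v| by rewrite ler_piMl// mulr_ge0.
    by have := normr_ge0 h; lra.
  move=> /(_ isT); rewrite ltr_norml [_ + x]addrC => /andP[A _].
  by move: A; rewrite ltrNl opprB ltrBlDr -ltrBlDl => /ltW.
have := taylor2_ge Cf T; rewrite D1; lra.
Qed.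

Lemma taylor2_local_le (R : realType) (V : normedModType R) (f : V -> R) x v
    (de : R) : Ck_on setT 2 f -> 0 < de ->
  exists2 r : R, 0 < r & forall h, `|h| < r ->
    f (x + h *: v) <= f x + h * 'D_v f x + h ^+ 2 / 2 * ('D_v ('D_v f) x + de).
Proof.
move=> Cf de0.
have CN : Ck_on setT 2 (fun x => -1 * f x) := Ck_mul (@smooth_cst R V (-1) 2) Cf.
have DN y : 'D_v (fun x => -1 * f x) y = - 'D_v f y.
  have -> : (fun x => -1 * f x) = - f by apply/funext => w; rewrite mulN1r.
  by rewrite deriveN//; exact: (Ck_on_derivable Cf).
have DDN : 'D_v (fun x => -1 * f x) = - 'D_v f by apply/funext => y; exact: DN.
have [r r0 Hr] := taylor2_local x v CN de0.
exists r => // h /Hr; rewrite DN DDN deriveN; last first.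
  exact: (Ck_on_derivable (Ck_on_derive v Cf)).
lra.
Qed.

Section ContinuousArith.
Context {R : realType} {T : topologicalType}.
Implicit Types f g : T -> R.

Lemma cont_add f g : continuous f -> continuous g -> continuous (fun x => f x + g x).
Proof. by move=> cf cg x; exact: (continuousD (cf x) (cg x)). Qed.

Lemma cont_sub f g : continuous f -> continuous g -> continuous (fun x => f x - g x).
Proof. by move=> cf cg x; exact: (continuousB (cf x) (cg x)). Qed.

Lemma cont_mul f g : continuous f -> continuous g -> continuous (fun x => f x * g x).
Proof. by move=> cf cg x; exact: (continuousM (cf x) (cg x)). Qed.

Lemma cont_cst (c : R) : continuous (fun _ : T => c).
Proof. exact: cst_continuous. Qed.

End ContinuousArith.

(** * The Euclidean scalar product, gradients and Hessians *)

Section Euclid.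
Context {R : realType} {d : nat}.
Implicit Types (x y z : 'rV[R]_d) (A : 'M[R]_d).

Definition dot x y : R := \sum_j x 0 j * y 0 j.

Lemma dotC x y : dot x y = dot y x.
Proof. by apply: eq_bigr => j _; rewrite mulrC. Qed.

Lemma dotDl x y z : dot (x + y) z = dot x z + dot y z.
Proof. by rewrite -big_split; apply: eq_bigr => j _; rewrite mxE mulrDl. Qed.

Lemma dotDr x y z : dot x (y + z) = dot x y + dot x z.
Proof. by rewrite dotC dotDl !(dotC _ x). Qed.

Lemma dotZl (c : R) x y : dot (c *: x) y = c * dot x y.
Proof. by rewrite /dot big_distrr /=; apply: eq_bigr => j _; rewrite mxE mulrA. Qed.

Lemma dotZr (c : R) x y : dot x (c *: y) = c * dot x y.
Proof. by rewrite dotC dotZl dotC. Qed.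

Lemma dotNl x y : dot (- x) y = - dot x y.
Proof. by rewrite -scaleN1r dotZl mulN1r. Qed.

Lemma dotNr x y : dot x (- y) = - dot x y.
Proof. by rewrite dotC dotNl dotC. Qed.

Lemma dot0l x : dot 0 x = 0.
Proof. by rewrite -(scale0r 0) dotZl mul0r. Qed.

Lemma dot0r x : dot x 0 = 0.
Proof. by rewrite dotC dot0l. Qed.

Definition dotE := (dotDl, dotDr, dotNl, dotNr, dotZl, dotZr, dot0l, dot0r).

Lemma dot_ge0 x : 0 <= dot x x.
Proof. by apply: sumr_ge0 => j _; rewrite -expr2 sqr_ge0. Qed.

Lemma dot_le x y : dot x y *+ 2 <= dot x x + dot y y.
Proof.
rewrite -subr_ge0; have := dot_ge0 (x - y); rewrite !dotE (dotC y x).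
congr (0 <= _); ring.
Qed.

Lemma dot_deltar x j : dot x (delta_mx 0 j) = x 0 j.
Proof.
rewrite /dot (bigD1 j)//= mxE !eqxx mulr1 big1 ?addr0// => i ij.
by rewrite mxE (negbTE ij) andbF mulr0.
Qed.

Lemma normr_coord x j : `|x 0 j| <= `|x|.
Proof.
by rewrite [leRHS]/Num.norm/= mx_normrE; apply/bigmax_geP; right; exists (0, j).
Qed.

Lemma normr_row_le x (c : R) : 0 <= c -> (forall j, `|x 0 j| <= c) -> `|x| <= c.
Proof.
move=> c0 xc; rewrite /Num.norm/= mx_normrE.
by apply: bigmax_le => // -[i j] _ /=; rewrite ord1.
Qed.

Lemma sqr_norm_le_dot x : `|x| ^+ 2 <= dot x x.
Proof.
rewrite -[leRHS]sqr_sqrtr ?dot_ge0// lerXn2r ?nnegrE ?sqrtr_ge0//.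
apply: normr_row_le => [|j]; first exact: sqrtr_ge0.
rewrite -sqrtr_sqr ler_wsqrtr// /dot (bigD1 j)//= -expr2 lerDl.
by apply: sumr_ge0 => i _; rewrite -expr2 sqr_ge0.
Qed.

Lemma qform_bilin A x : qform A x = dot (x *m A) x.
Proof. by rewrite /qform mxE; apply: eq_bigr => j _; rewrite !mxE. Qed.

Lemma qform_scalar (c : R) x : qform c%:M x = c * dot x x.
Proof. by rewrite qform_bilin mul_mx_scalar dotZl. Qed.

Lemma qformZ A (c : R) x : qform A (c *: x) = c ^+ 2 * qform A x.
Proof. by rewrite !qform_bilin -scalemxAl !dotE; ring. Qed.

Lemma qformN A x : qform (- A) x = - qform A x.
Proof. by rewrite !qform_bilin mulmxN dotNl. Qed.

Lemma dot_mulmx x y A : dot (x *m A) y = dot x (y *m A^T).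
Proof.
rewrite /dot.
transitivity (\sum_j \sum_i x 0 i * A i j * y 0 j).
  by apply: eq_bigr => j _; rewrite mxE big_distrl.
rewrite exchange_big; apply: eq_bigr => i _; rewrite mxE big_distrr /=.
by apply: eq_bigr => j _; rewrite mxE; ring.
Qed.

Lemma qform_conj A (S : 'M[R]_d) x : S^T = S ->
  qform (S *m A *m S) x = qform A (x *m S).
Proof.
by move=> St; rewrite !qform_bilin !mulmxA dot_mulmx St.
Qed.

Lemma qform_ub A : exists2 b : R, 0 <= b & forall x, `|qform A x| <= b * dot x x.
Proof.
exists (\sum_j \sum_i `|A i j|).
  by apply: sumr_ge0 => j _; apply: sumr_ge0.
move=> x; rewrite qform_bilin /dot (le_trans (ler_norm_sum _ _ _))// big_distrl.
apply: ler_sum => j _; rewrite mxE normrM big_distrl /=.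
rewrite (le_trans (ler_wpM2r _ (ler_norm_sum _ _ _)))// big_distrl /=.
apply: ler_sum => i _; rewrite normrM mulrAC mulrC ler_wpM2l//.
have H k : x 0 k ^+ 2 <= dot x x.
  rewrite /dot (bigD1 k)//= -expr2 lerDl.
  by apply: sumr_ge0 => l _; rewrite -expr2 sqr_ge0.
have := H i; have := H j; have := sqr_ge0 (`|x 0 i| - `|x 0 j|).
rewrite -(real_normK (num_real (x 0 i))) -(real_normK (num_real (x 0 j))).
rewrite -/(dot x x); nra.
Qed.

Lemma row_delta x : x = \sum_j x 0 j *: delta_mx 0 j.
Proof.
apply/rowP => i; rewrite summxE (bigD1 i)//= !mxE !eqxx mulr1 big1 ?addr0//.
by move=> j ji; rewrite !mxE eq_sym (negbTE ji) andbF mulr0.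
Qed.

Lemma derive_grad (f : 'rV[R]_d -> R) x v : Ck_on setT 1 f ->
  'D_v f x = dot v (grad f x).
Proof.
move=> Cf; rewrite {1}(row_delta v) (@derive_sumv _ _ f setT)//; last exact: openT.
by apply: eq_bigr => j _; rewrite mxE.
Qed.

Lemma derive2_hess (f : 'rV[R]_d -> R) x v : Ck_on setT 2 f ->
  'D_v ('D_v f) x = qform (hess f x) v.
Proof.
move=> Cf; have C1 := Ck_on_C1 Cf.
have -> : 'D_v f = \sum_j v 0 j \*: 'D_(delta_mx 0 j) f.
  apply/funext => y; rewrite derive_grad// fct_sumE.
  by apply: eq_bigr => j _; rewrite mxE.
have Cj j : Ck_on setT 1 ('D_(delta_mx 0 j) f) by exact: Ck_on_derive.
rewrite derive_sum; last first.
  by move=> j; apply: derivableZ; exact: (Ck_on_derivable (Cj j)).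
rewrite qform_bilin; apply: eq_bigr => j _.
rewrite deriveZ; last by exact: (Ck_on_derivable (Cj j)).
rewrite derive_grad// mulrC; congr (_ * _).
by rewrite mxE; apply: eq_bigr => i _; rewrite !mxE.
Qed.

End Euclid.

(** * The comparison principle *)

(** Superlevel sets form a filter base because the values are totally ordered,
    and at a cluster point of that filter [f] cannot lie strictly below any of
    the levels. *)
Lemma usc_compact_max (T : topologicalType) (R : realType) (A : set T)
    (f : T -> R) : A !=set0 -> compact A ->
  (forall x, A x -> forall c, f x < c -> \forall y \near x, A y -> f y < c) ->
  exists2 x, A x & forall y, A y -> f y <= f x.
Proof.
move=> [a0 Aa0] cA uscf.
pose B y := [set z | A z /\ f y <= f z].
have PF : ProperFilter (filter_from A B).
  apply: filter_from_proper; last by move=> y Ay; exists y; split.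
  apply: filter_from_filter; first by exists a0.
  move=> i j Ai Aj; have [fij|/ltW fji] := leP (f i) (f j).
    by exists j => // z [Az fz]; split; split=> //; exact: le_trans fz.
  by exists i => // z [Az fz]; split; split=> //; exact: le_trans fz.
have FA : filter_from A B A by exists a0 => // z [].
have [x [Ax clx]] := cA _ PF FA.
exists x => // y Ay; rewrite leNgt; apply/negP => fxy.
have [|z [[Az fyz] fzy]] := clx (B y) _ _ (uscf x Ax _ fxy); first by exists y.
by have := lt_le_trans (fzy Az) fyz; rewrite ltxx.
Qed.

Section Space.
Context {R : realType} {d : nat}.
Local Notation V := 'rV[R]_d.

Lemma compact_row_ball (r : R) : compact [set x : V | `|x| <= r].
Proof.
apply: bounded_closed_compact.
  exists r; split; first exact: num_real.
  by move=> M rM x /= xr; apply: ltW; exact: le_lt_trans rM.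
apply: (@closed_comp _ _ (@Num.norm R V) [set y | y <= r]); last exact: closed_le.
by move=> x _; exact: norm_continuous.
Qed.

(** Only [p] is confined to the ball, so that a perturbation of a bounded
    gradient may leave it. *)
Lemma continuous_unif_ball (G : V -> R) (B e : R) : continuous G -> 0 < e ->
  exists2 k : R, 0 < k &
    forall p q, `|p| <= B -> `|q - p| <= k -> `|G q - G p| < e.
Proof.
move=> cG e0.
have := @compact_row_ball B; rewrite compact_near_coveringP.
move=> /(_ R (0^'+) (fun k p => forall q, `|q - p| <= k -> `|G q - G p| < e)).
case=> [p _|k k0 Hk].
  have e2 : 0 < e / 2 by rewrite divr_gt0.
  have [r r0 Hr] := (continuous_atP _ _).1 (cG p) _ e2.
  exists ([set p' | `|p' - p| < r / 2], [set k : R | k < r / 2]).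
    split=> /=; last by apply: nbhs_right_lt; rewrite divr_gt0.
    by apply/(near_normP p); exists (r / 2); rewrite ?divr_gt0.
  move=> [p' k] /= [pp' kr] q qp'.
  have A : `|G p' - G p| < e / 2 by apply: Hr; lra.
  have B' : `|G q - G p| < e / 2.
    apply: Hr; rewrite -(subrK p' q) -addrA.
    rewrite (le_lt_trans (ler_normD _ _))//; lra.
  have -> : G q - G p' = (G q - G p) - (G p' - G p) by ring.
  rewrite (le_lt_trans (ler_normB _ _))//; lra.
exists (k / 2); first by rewrite divr_gt0.
move=> p q pB qk; apply: (Hk (k / 2)) qk => //=; last by rewrite divr_gt0.
by rewrite sub0r normrN gtr0_norm ?divr_gt0// ltr_pdivrMr// ltr_pMr// ltr1n.
Qed.

Lemma continuous_coord1 j : continuous (fun z : V * R => z.1 0 j).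
Proof.
move=> z; apply: (@continuous_comp _ _ _ fst (fun x : V => x 0 j)).
  exact: cvg_fst.
exact: coord_continuous.
Qed.

Lemma smooth_sqdist (b : V) :
  smooth (fun z : V * R => dot (z.1 - b) (z.1 - b)).
Proof.
have sj j : smooth (fun z : V * R => (z.1 - b) 0 j).
  apply: (@smooth_affine _ _ _ (fun z : V * R => z.1 0 j)).
    move=> z; rewrite (_ : (fun _ => _) = (fun z : V * R => z.1 0 j - b 0 j)).
      apply: continuousB; [exact: continuous_coord1|exact: cst_continuous].
    by apply/funext => y; rewrite !mxE.
  by move=> x v h; rewrite !mxE; ring.
by apply: smooth_sum => j; apply: smooth_mul; exact: sj.
Qed.

Lemma smooth_time (s : R) : smooth (fun z : V * R => z.2 - s).
Proof.
apply: (@smooth_affine _ _ _ (fun z : V * R => z.2)).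
  by move=> z; apply: continuousB; [exact: cvg_snd|exact: cst_continuous].
by move=> x v h /=; rewrite /GRing.scale/=; ring.
Qed.

(** The test functions of the doubling argument: [c1] and [c3] tie the point
    to [(b, s)], while [c2] confines it in space and [c4] in time. *)
Definition penalty (c1 c2 c3 c4 : R) (b : V) (s : R) (z : V * R) : R :=
  c1 * dot (z.1 - b) (z.1 - b) + c2 * dot z.1 z.1
  + (c3 * ((z.2 - s) * (z.2 - s)) + c4 * (z.2 + z.2 * z.2)).

Lemma smooth_penalty c1 c2 c3 c4 b s : smooth (penalty c1 c2 c3 c4 b s).
Proof.
have s0 : smooth (fun z : V * R => dot z.1 z.1).
  rewrite (_ : (fun _ => _) = (fun z : V * R => dot (z.1 - 0) (z.1 - 0))).
    exact: smooth_sqdist.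
  by apply/funext => z; rewrite subr0.
have t0 : smooth (fun z : V * R => z.2).
  rewrite (_ : (fun _ => _) = (fun z : V * R => z.2 - 0)).
    exact: smooth_time.
  by apply/funext => z; rewrite subr0.
apply: smooth_add; apply: smooth_add; apply: smooth_mul;
  do ?[exact: smooth_cst|exact: smooth_sqdist|exact: s0].
  by apply: smooth_mul; exact: smooth_time.
by apply: smooth_add => //; exact: smooth_mul.
Qed.

Lemma penalty_time_deriv c1 c2 c3 c4 b s z :
  time_deriv (penalty c1 c2 c3 c4 b s) z = 2 * c3 * (z.2 - s) + c4 * (1 + 2 * z.2).
Proof.
rewrite /time_deriv derive1E.
suff H : is_derive z.2 (1 : R) (fun t => penalty c1 c2 c3 c4 b s (z.1, t))
   (2 * c3 * (z.2 - s) + c4 * (1 + 2 * z.2)) by rewrite derive_val.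
apply: (is_derive_expand (M := `|c3 + c4|)) => h _.
have -> : h *: (1 : R) = h by exact: mulr1.
rewrite /penalty /= (_ : _ - _ - _ = (c3 + c4) * h ^+ 2); last by ring.
by rewrite normrM (ger0_norm (sqr_ge0 h)).
Qed.

Lemma penalty_space_grad c1 c2 c3 c4 b s z :
  space_grad (penalty c1 c2 c3 c4 b s) z =
    (2 * c1) *: (z.1 - b) + (2 * c2) *: z.1.
Proof.
apply/rowP => j; rewrite !mxE.
set c := RHS; set e := delta_mx 0 j.
suff H : is_derive z.1 e (fun x => penalty c1 c2 c3 c4 b s (x, z.2)) c.
  by rewrite derive_val.
apply: (is_derive_expand (M := `|(c1 + c2) * dot e e|)) => h _.
have E : dot (z.1 - b) e = z.1 0 j - b 0 j by rewrite dot_deltar !mxE.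
have E' : dot z.1 e = z.1 0 j by rewrite dot_deltar.
rewrite /penalty /= (_ : _ - _ - _ = (c1 + c2) * dot e e * h ^+ 2).
  by rewrite normrM (ger0_norm (sqr_ge0 h)).
rewrite [z.1 + _ - b]addrAC /c; move: (z.1 - b) E => y E.
rewrite !(dotDl, dotDr, dotZl, dotZr) (dotC e y) (dotC e z.1) E E'.
ring.
Qed.

End Space.

Section Comparison.
Context {R : realType} {d : nat}.
Local Notation V := 'rV[R]_d.
Implicit Types (u w : V * R -> R).

(** Upper semicontinuity relative to the closed half-space, so that values at
    negative times do not matter. *)
Definition usc_half u := forall z, 0 <= z.2 -> forall c, u z < c ->
  \forall y \near z, 0 <= y.2 -> u y < c.

Lemma near_fst (T U : topologicalType) (x : T) (y : U) (P : T -> Prop) :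
  (\forall z \near x, P z) -> \forall z \near (x, y), P z.1.
Proof. by move=> H; exact: (@filter_prod1 _ _ (nbhs x) (nbhs y) _ P H). Qed.

Lemma near_snd (T U : topologicalType) (x : T) (y : U) (P : U -> Prop) :
  (\forall z \near y, P z) -> \forall z \near (x, y), P z.2.
Proof. by move=> H; exact: (@filter_prod2 _ _ (nbhs x) (nbhs y) _ P H). Qed.

Lemma near_time_gt0 (z : V * R) : 0 < z.2 -> \forall y \near z, 0 < y.2.
Proof.
by case: z => x t /= t0; apply: (@near_snd _ _ x t (fun s => 0 < s)); exact: lt_nbhsr.
Qed.

(** Doubling of variables for [u - w]: [a] penalises the distance of the two
    points, [de] confines them in space, and [et] confines the time. The time
    term has derivative at least [et], which makes the subsolution inequality
    strict, and its quadratic part dominates the linear growth of [u] and [w].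
    *)
Definition doubled (a de et : R) u w (z : (V * R) * (V * R)) : R :=
  u z.1 - w z.2 - (a * dot (z.1.1 - z.2.1) (z.1.1 - z.2.1)
    + a * ((z.1.2 - z.2.2) * (z.1.2 - z.2.2))
    + de * (dot z.1.1 z.1.1 + dot z.2.1 z.2.1) + et * (z.1.2 + z.1.2 * z.1.2)).

(** Freezing one of the two points turns the penalisation into a test function
    of the other one, up to a constant. *)
Lemma penalty_doubled1 a de et (z : (V * R) * (V * R)) :
  a * dot (z.1.1 - z.2.1) (z.1.1 - z.2.1)
    + a * ((z.1.2 - z.2.2) * (z.1.2 - z.2.2))
    + de * (dot z.1.1 z.1.1 + dot z.2.1 z.2.1) + et * (z.1.2 + z.1.2 * z.1.2)
  = penalty a de a et z.2.1 z.2.2 z.1 + de * dot z.2.1 z.2.1.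
Proof. rewrite /penalty; ring. Qed.

Lemma penalty_doubled2 a de et (z : (V * R) * (V * R)) :
  a * dot (z.1.1 - z.2.1) (z.1.1 - z.2.1)
    + a * ((z.1.2 - z.2.2) * (z.1.2 - z.2.2))
    + de * (dot z.1.1 z.1.1 + dot z.2.1 z.2.1) + et * (z.1.2 + z.1.2 * z.1.2)
  = - penalty (- a) (- de) (- a) 0 z.1.1 z.1.2 z.2 + de * dot z.1.1 z.1.1
    + et * (z.1.2 + z.1.2 * z.1.2).
Proof.
rewrite /penalty -(opprB z.1.1 z.2.1) dotNl dotNr opprK; ring.
Qed.

Lemma continuous_dot (T : topologicalType) (f g : T -> V) :
  continuous f -> continuous g -> continuous (fun x => dot (f x) (g x)).
Proof.
move=> cf cg; rewrite /dot; apply: continuous_big => [|j _ x].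
  exact: add_continuous.
apply: cvgM.
  exact: (continuous_comp (@cf x) (@coord_continuous _ _ _ _ _ _)).
exact: (continuous_comp (@cg x) (@coord_continuous _ _ _ _ _ _)).
Qed.

(** The bound [A] depends neither on [a] nor on [de]; hence [a] can be taken
    large and then [de] small once [et] is fixed. *)
Lemma doubled_bounds a de et M N u w z :
  0 <= de -> 0 < et -> 0 <= N -> N <= a -> 1 <= a ->
  (forall z, 0 <= z.2 -> u z <= M + N * z.2) ->
  (forall z, 0 <= z.2 -> - (M + N * z.2) <= w z) ->
  0 <= z.1.2 -> 0 <= z.2.2 -> 0 <= doubled a de et u w z ->
  let A := 2 * M + N + 2 * N ^+ 2 / et in
  [/\ a * dot (z.1.1 - z.2.1) (z.1.1 - z.2.1) <= A,
      a * (z.1.2 - z.2.2) ^+ 2 <= 2 * A,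
      de * dot z.1.1 z.1.1 <= A,
      de * dot z.2.1 z.2.1 <= A
    & et * z.1.2 ^+ 2 <= 2 * A].
Proof.
move=> de0 et0 N0 Na a1 ub wb t0 s0; rewrite /doubled /=.
have := ub _ t0; have := wb _ s0.
have a0 : 0 <= a by exact: le_trans a1.
have := mulr_ge0 a0 (dot_ge0 (z.1.1 - z.2.1)).
have := mulr_ge0 de0 (dot_ge0 z.1.1); have := mulr_ge0 de0 (dot_ge0 z.2.1).
move: (dot _ _) (dot _ _) (dot _ _) (u _) (w _) => D1 D2 D3 U W.
move: z.1.2 z.2.2 t0 s0 => t s t0 s0 P1 P2 P3 HW HU HD.
have sq : 2 * N * t <= et / 2 * t ^+ 2 + 2 * N ^+ 2 / et.
  rewrite -subr_ge0 (_ : _ - _ = (et * t - 2 * N) ^+ 2 / (2 * et)).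
    by rewrite divr_ge0 ?sqr_ge0// mulr_ge0// ltW.
  by field; rewrite gt_eqF.
have H1 : N * (s - t) <= N + a / 2 * (t - s) ^+ 2.
  have : 0 <= (a - N) * (t - s) ^+ 2 by rewrite mulr_ge0 ?subr_ge0 ?sqr_ge0.
  have : 0 <= N * (1 + (t - s)) ^+ 2 by rewrite mulr_ge0 ?sqr_ge0.
  nra.
have Pt : 0 <= et * t by rewrite mulr_ge0// ltW.
have P4 : 0 <= a * (t - s) ^+ 2 by rewrite mulr_ge0// sqr_ge0.
have P5 : 0 <= et * t ^+ 2 by rewrite mulr_ge0 ?sqr_ge0// ltW.
move: (2 * N ^+ 2 / et) sq => Q sq.
have key : a * D1 + a / 2 * (t - s) ^+ 2 + de * D2 + de * D3 + et / 2 * t ^+ 2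
    <= 2 * M + N + Q.
  move: HW HU HD sq H1 Pt; clear; lra.
by split; move: P1 P2 P3 P4 P5 key; clear; lra.
Qed.

Lemma ler_sqr1 (y : R) : y <= 1 + y ^+ 2.
Proof. nra. Qed.

(** By the bounds above the doubled function is negative outside a compact
    box, so its maximum over that box is global. *)
Lemma doubled_max a de et M N u w z0 :
  0 < de -> 0 < et -> 0 <= M -> 0 <= N -> N <= a -> 1 <= a ->
  (forall z, 0 <= z.2 -> u z <= M + N * z.2) ->
  (forall z, 0 <= z.2 -> - (M + N * z.2) <= w z) ->
  usc_half u -> usc_half (- w) ->
  0 <= z0.1.2 -> 0 <= z0.2.2 -> 0 <= doubled a de et u w z0 ->
  exists z, [/\ 0 <= z.1.2, 0 <= z.2.2 & forall y, 0 <= y.1.2 -> 0 <= y.2.2 ->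
    doubled a de et u w y <= doubled a de et u w z].
Proof.
move=> de0 et0 M0 N0 Na a1 ub wb uu uw t0 s0 D0.
pose A := 2 * M + N + 2 * N ^+ 2 / et.
have A0 : 0 <= A.
  by rewrite !addr_ge0// ?mulr_ge0// ?invr_ge0 ?sqr_ge0// ltW.
pose r := 3 + A / de + 2 * A / et + 2 * A / a.
have a0 : 0 < a by exact: lt_le_trans a1.
have Ade : 0 <= A / de by rewrite divr_ge0// ltW.
have Aet : 0 <= 2 * A / et by rewrite divr_ge0// ?mulr_ge0// ltW.
have Aa : 0 <= 2 * A / a by rewrite divr_ge0// ?mulr_ge0// ltW.
pose X := [set x : V | `|x| <= r].
pose K := (X `*` `[0, r]) `*` (X `*` `[0, r]).
have inK z : 0 <= z.1.2 -> 0 <= z.2.2 -> 0 <= doubled a de et u w z -> K z.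
  move=> tz sz Dz.
  have := doubled_bounds (ltW de0) et0 N0 Na a1 ub wb tz sz Dz.
  rewrite -/A => -[_ m4 m2 m3 m5].
  have b2 : dot z.1.1 z.1.1 <= A / de by rewrite ler_pdivlMr// mulrC.
  have b3 : dot z.2.1 z.2.1 <= A / de by rewrite ler_pdivlMr// mulrC.
  have b4 : (z.1.2 - z.2.2) ^+ 2 <= 2 * A / a by rewrite ler_pdivlMr// mulrC.
  have b5 : z.1.2 ^+ 2 <= 2 * A / et by rewrite ler_pdivlMr// mulrC.
  have n1 := le_trans (sqr_norm_le_dot z.1.1) b2.
  have n2 := le_trans (sqr_norm_le_dot z.2.1) b3.
  have q1 := ler_sqr1 `|z.1.1|; have q2 := ler_sqr1 `|z.2.1|.
  have q3 := ler_sqr1 z.1.2; have q4 := ler_sqr1 (- (z.1.2 - z.2.2)).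
  rewrite sqrrN in q4.
  split; split=> /=; rewrite ?in_itv/= ?tz ?sz/= /X/= /r;
    move: Ade Aet Aa n1 n2 b4 b5 q1 q2 q3 q4;
    move: (A / de) (2 * A / et) (2 * A / a) => ? ? ?; clear; lra.
have cK : compact K.
  by do 2!apply: compact_setX; (exact: compact_row_ball || exact: segment_compact).
have KN : K !=set0 by exists z0; exact: inK.
have Kt z : K z -> 0 <= z.1.2 /\ 0 <= z.2.2.
  by move=> [[_ /=]]; rewrite in_itv/= => /andP[-> _] [_ /=]; rewrite in_itv/= => /andP[-> _].
pose P (z : (V * R) * (V * R)) := (a * dot (z.1.1 - z.2.1) (z.1.1 - z.2.1)
    + a * ((z.1.2 - z.2.2) * (z.1.2 - z.2.2))
    + de * (dot z.1.1 z.1.1 + dot z.2.1 z.2.1) + et * (z.1.2 + z.1.2 * z.1.2)).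
have c11 : continuous (fun z : (V * R) * (V * R) => z.1.1).
  by move=> z; apply: (@continuous_comp _ _ _ fst fst); exact: cvg_fst.
have c21 : continuous (fun z : (V * R) * (V * R) => z.2.1).
  by move=> z; apply: (@continuous_comp _ _ _ snd fst); [exact: cvg_snd|exact: cvg_fst].
have c12 : continuous (fun z : (V * R) * (V * R) => z.1.2).
  by move=> z; apply: (@continuous_comp _ _ _ fst snd); [exact: cvg_fst|exact: cvg_snd].
have c22 : continuous (fun z : (V * R) * (V * R) => z.2.2).
  by move=> z; apply: (@continuous_comp _ _ _ snd snd); exact: cvg_snd.
have cP : continuous P.
  have c1 : continuous (fun z : (V * R) * (V * R) => z.1.1 - z.2.1).
    by move=> z; apply: cvgB; [exact: c11|exact: c21].
  move=> z; apply: cvgD; [apply: cvgD; [apply: cvgD|]|]; apply: cvgM;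
    try exact: cvg_cst.
  - exact: (continuous_dot c1 c1).
  - by apply: cvgM; apply: cvgB; [exact: c12|exact: c22|exact: c12|exact: c22].
  - by apply: cvgD; [exact: (continuous_dot c11 c11)|exact: (continuous_dot c21 c21)].
  - by apply: cvgD; [|apply: cvgM]; exact: c12.
have uD z : K z -> forall c, doubled a de et u w z < c ->
    \forall y \near z, K y -> doubled a de et u w y < c.
  move=> Kz c Hc; have [z1 z2] := Kt z Kz.
  pose g := (c - doubled a de et u w z) / 3.
  have g0 : 0 < g by rewrite divr_gt0// subr_gt0.
  have H1 : \forall y \near z, 0 <= y.1.2 -> u y.1 < u z.1 + g.
    case: z z1 {z2 Hc Kz} @g g0 => za zb z1 g g0.
    apply: (@near_fst _ _ za zb (fun y => 0 <= y.2 -> u y < u za + g)).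
    by apply: uu => //; rewrite ltrDl.
  have H2 : \forall y \near z, 0 <= y.2.2 -> - w y.2 < - w z.2 + g.
    case: z z2 {z1 Hc Kz H1} @g g0 => za zb z1 g g0.
    apply: (@near_snd _ _ za zb (fun y => 0 <= y.2 -> - w y < - w zb + g)).
    by apply: uw => //; rewrite ltrDl.
  have H3 : \forall y \near z, `|P z - P y| < g.
    by move/cvgrPdist_lt: (cP z); apply.
  apply: filterS3 H1 H2 H3 => y h1 h2 h3 Ky; have [y1 y2] := Kt y Ky.
  have {}h1 := h1 y1; have {}h2 := h2 y2.
  have e1 : doubled a de et u w y = u y.1 - w y.2 - P y by [].
  have e2 : doubled a de et u w z = u z.1 - w z.2 - P z by [].
  move: h3; rewrite ltr_norml => /andP[h3 h4].
  rewrite e1; move: g0 h1 h2 h3 h4; rewrite /g e2; lra.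
have [z Kz zmax] := usc_compact_max KN cK uD.
have [z1 z2] := Kt z Kz; exists z; split=> // y y1 y2.
have [Dy|/ltW Dy] := leP 0 (doubled a de et u w y); first exact/zmax/inK.
by apply: (le_trans Dy); apply: (le_trans D0); apply: zmax; exact: inK.
Qed.

End Comparison.

Section ComparisonTheorem.
Context {R : realType} {d : nat}.
Local Notation V := 'rV[R]_d.
Implicit Types (u w : V * R -> R).

(** The two viscosity inequalities at an interior maximum are subtracted: the
    time derivatives of the coupling cancel and [et] remains. *)
Lemma doubled_max_touch (G : V -> R) u w a de et (z : (V * R) * (V * R)) :
  viscosity_subsolution G u -> viscosity_supersolution G w ->
  0 <= et -> 0 < z.1.2 -> 0 < z.2.2 ->
  (forall y, 0 <= y.1.2 -> 0 <= y.2.2 ->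
    doubled a de et u w y <= doubled a de et u w z) ->
  et <= G ((2 * a) *: (z.1.1 - z.2.1) + (2 * de) *: z.1.1)
      - G ((2 * a) *: (z.1.1 - z.2.1) - (2 * de) *: z.2.1).
Proof.
move=> subu supw et0 t0 s0 zmax.
have H1 : 2 * a * (z.1.2 - z.2.2) + et * (1 + 2 * z.1.2) <=
    G ((2 * a) *: (z.1.1 - z.2.1) + (2 * de) *: z.1.1).
  have := subu (penalty a de a et z.2.1 z.2.2) z.1 _ t0 _.
  rewrite penalty_time_deriv penalty_space_grad; apply.
    by apply: Ck_on_sub (@subsetT _ _) _; exact: smooth_penalty.
  apply: filterS (near_time_gt0 t0) => y /ltW y0.
  have := zmax (y, z.2) y0 (ltW s0); rewrite /doubled !penalty_doubled1 /=; lra.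
have H2 : G ((2 * a) *: (z.1.1 - z.2.1) - (2 * de) *: z.2.1) <=
    2 * a * (z.1.2 - z.2.2).
  have := supw (penalty (- a) (- de) (- a) 0 z.1.1 z.1.2) z.2 _ s0 _.
  rewrite penalty_time_deriv penalty_space_grad !mulrN !scaleNr -scalerN opprB.
  rewrite mul0r addr0 mulNr -mulrN opprB; apply.
    by apply: Ck_on_sub (@subsetT _ _) _; exact: smooth_penalty.
  apply: filterS (near_time_gt0 s0) => y /ltW y0.
  have := zmax (z.1, y) (ltW t0) y0; rewrite /doubled !penalty_doubled2 /=; lra.
have : 0 <= et * z.1.2 by rewrite mulr_ge0// ltW.
lra.
Qed.

(** At a point where [u > w], the parameters are chosen in the order [et],
    [a], [de]. A small [et] keeps the maximum of the doubled function
    positive; a large [a] brings the two points of the maximum together, hence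
    away from the initial time, where [u] and [w] are ordered; a small [de]
    makes the two gradients, which differ by a multiple of the square root of
    [de], have close images under [G], against the gap [et]. *)
Lemma comparison (G : V -> R) u w (M N : R) :
  continuous G -> 0 <= M -> 0 <= N ->
  viscosity_subsolution G u -> viscosity_supersolution G w ->
  (forall z, 0 <= z.2 -> u z <= M + N * z.2) ->
  (forall z, 0 <= z.2 -> - (M + N * z.2) <= w z) ->
  usc_half u -> usc_half (- w) ->
  (forall e, 0 < e -> exists2 r : R, 0 < r & forall z1 z2 : V * R,
     0 <= z1.2 < r -> 0 <= z2.2 < r -> `|z1.1 - z2.1| < r -> u z1 - w z2 <= e) ->
  forall z, 0 <= z.2 -> u z <= w z.
Proof.
move=> cG M0 N0 subu supw ub wb uu uw init zb zb0; rewrite leNgt; apply/negP => wu.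
pose sg := (u zb - w zb) / 3.
have sg0 : 0 < sg by rewrite divr_gt0// subr_gt0.
pose q := 1 + zb.2 + zb.2 * zb.2.
have q0 : 0 < q by rewrite /q; nra.
pose et := sg / q; have et0 : 0 < et by rewrite divr_gt0.
pose A := 2 * M + N + 2 * N ^+ 2 / et.
have A0 : 0 <= A.
  by rewrite !addr_ge0// ?mulr_ge0// ?invr_ge0 ?sqr_ge0// ltW.
have [|r r0 Hr] := init (sg / 2); first by rewrite divr_gt0.
pose a := 1 + N + 4 * A / r ^+ 2.
have Ar : 0 <= 4 * A / r ^+ 2 by rewrite divr_ge0 ?sqr_ge0// mulr_ge0.
have a1 : 1 <= a by rewrite /a; lra.
have Na : N <= a by rewrite /a; lra.
have a0 : 0 < a by exact: lt_le_trans a1.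
have Aa : 2 * A / a < r ^+ 2.
  rewrite ltr_pdivrMr// /a.
  have -> : r ^+ 2 * (1 + N + 4 * A / r ^+ 2) = r ^+ 2 * (1 + N) + 4 * A.
    by field; rewrite gt_eqF.
  have : 0 < r ^+ 2 * (1 + N) by rewrite mulr_gt0 ?exprn_gt0//; lra.
  lra.
have et2 : 0 < et / 2 by rewrite divr_gt0.
have [k k0 Hk] := continuous_unif_ball (2 * a * r + 1) cG et2.
pose k1 := Num.min k 1.
have k10 : 0 < k1 by rewrite lt_min k0 ltr01.
pose Q := 1 + 4 * A + 2 * dot zb.1 zb.1.
have Q0 : 0 < Q by rewrite /Q; have := dot_ge0 zb.1; lra.
pose de := Num.min (k1 ^+ 2 / Q) (sg / Q).
have de0 : 0 < de.
  by rewrite lt_min; apply/andP; split; apply: divr_gt0 => //; exact: exprn_gt0.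
have de1 : de * Q <= k1 ^+ 2 by rewrite -ler_pdivlMr// ge_min lexx.
have de2 : de * Q <= sg by rewrite -ler_pdivlMr// ge_min lexx orbT.
have dA : 4 * (de * A) <= k1 ^+ 2.
  have := dot_ge0 zb.1; have : 0 <= de * dot zb.1 zb.1 by rewrite mulr_ge0 ?dot_ge0// ltW.
  move: de1; rewrite /Q; lra.
have Dzb : sg <= doubled a de et u w (zb, zb).
  rewrite /doubled /= !subrr dot0l !mulr0 !add0r.
  have : et * (zb.2 + zb.2 * zb.2) <= sg.
    have -> : sg = et * q by rewrite /et divfK// gt_eqF.
    by rewrite ler_pM2l// /q; lra.
  have : 0 <= de * A by rewrite mulr_ge0// ltW.
  have -> : u zb - w zb = 3 * sg by rewrite /sg mulrC divfK.
  move: de2; rewrite /Q; lra.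
have Dzb0 : 0 <= doubled a de et u w (zb, zb) by apply: le_trans Dzb; exact: ltW.
have [z [z1 z2 zmax]] := doubled_max de0 et0 M0 N0 Na a1 ub wb uu uw
  (z0 := (zb, zb)) zb0 zb0 Dzb0.
have Dz := le_trans Dzb (zmax (zb, zb) zb0 zb0).
have := doubled_bounds (ltW de0) et0 N0 Na a1 ub wb z1 z2 (le_trans (ltW sg0) Dz).
rewrite -/A => -[m1 m4 m2 m3 m5].
have xyr : `|z.1.1 - z.2.1| < r.
  rewrite -(ltr_pXn2r (n := 2))// ?nnegrE ?(ltW r0)//.
  apply: le_lt_trans Aa; apply: (le_trans (sqr_norm_le_dot _)).
  by rewrite ler_pdivlMr// mulrC (le_trans m1)// ler_peMl// ler1n.
have tsr : `|z.1.2 - z.2.2| < r.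
  rewrite -(ltr_pXn2r (n := 2))// ?nnegrE ?(ltW r0)//.
  apply: le_lt_trans Aa; rewrite real_normK ?num_real//.
  by rewrite ler_pdivlMr// mulrC.
have uwlow : sg <= u z.1 - w z.2.
  apply: (le_trans Dz); rewrite /doubled lerBlDr lerDl -expr2.
  have p1 := mulr_ge0 (ltW a0) (dot_ge0 (z.1.1 - z.2.1)).
  have p2 := mulr_ge0 (ltW a0) (sqr_ge0 (z.1.2 - z.2.2)).
  have p3 := mulr_ge0 (ltW de0) (addr_ge0 (dot_ge0 z.1.1) (dot_ge0 z.2.1)).
  have p4 := mulr_ge0 (ltW et0) (addr_ge0 z1 (mulr_ge0 z1 z1)).
  by do 3!apply: addr_ge0 => //.
have ninit : ~ (z.1.2 < r /\ z.2.2 < r).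
  move=> [t1 t2]; have := Hr z.1 z.2; rewrite z1 z2 t1 t2 => /(_ isT isT xyr).
  by move: sg0 uwlow; clear; lra.
have t0 : 0 < z.1.2.
  rewrite lt_neqAle z1 andbT; apply/eqP => E; apply: ninit.
  move: tsr; rewrite -E sub0r normrN ger0_norm//.
have s0 : 0 < z.2.2.
  rewrite lt_neqAle z2 andbT; apply/eqP => E; apply: ninit.
  move: tsr; rewrite -E subr0 ger0_norm//.
have := doubled_max_touch subu supw (ltW et0) t0 s0 zmax.
have small (x : V) : de * dot x x <= A -> `|(2 * de) *: x| <= k1.
  move=> xA; rewrite -(ler_pXn2r (n := 2))// ?nnegrE ?(ltW k10)//.
  apply: (le_trans (sqr_norm_le_dot _)); rewrite !dotE.
  have : de * (de * dot x x) <= de * A by rewrite ler_pM2l.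
  by move: dA; clear; lra.
have sx : `|(2 * de) *: z.1.1| <= k1 by exact: small.
have sy : `|(2 * de) *: z.2.1| <= k1 by exact: small.
set p := (2 * a) *: (z.1.1 - z.2.1).
have pB : `|p| <= 2 * a * r + 1.
  rewrite normrZ gtr0_norm ?mulr_gt0//.
  by rewrite ler_wpDr// ler_pM2l ?mulr_gt0// ltW.
have k1k : k1 <= k by rewrite ge_min lexx.
have e1 := Hk p (p + (2 * de) *: z.1.1) pB.
have e2 := Hk p (p - (2 * de) *: z.2.1) pB.
rewrite addrC addKr in e1; rewrite addrC addKr normrN in e2.
have {}e1 := e1 (le_trans sx k1k); have {}e2 := e2 (le_trans sy k1k).
move: e1 e2; rewrite !ltr_norml => /andP[_ A1] /andP[A2 _].
by move: A1 A2; clear; lra.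
Qed.

End ComparisonTheorem.

(** * The Legendre transform and the Hopf-Lax formula *)

Section Legendre.
Context {R : realType} {d : nat}.
Local Notation V := 'rV[R]_d.

Definition strongly_convex (H : V -> R) (DH : V -> V) (th : R) :=
  forall p q, H p + dot (q - p) (DH p) + th / 2 * dot (q - p) (q - p) <= H q.

Definition legendre (H : V -> R) (q : V) : R :=
  sup (range (fun p => dot p q - H p)).

Variables (H : V -> R) (DH : V -> V) (th : R).
Hypotheses (th0 : 0 < th) (HSC : strongly_convex H DH th).
Local Notation L := (legendre H).

Lemma legendre_bound p q r :
  dot r q - H r <= dot p q - H p + dot (r - p) (q - DH p)
    - th / 2 * dot (r - p) (r - p).
Proof.
have := HSC p r; rewrite !(dotDr _ q) !dotNr !(dotDl _ _ q) !dotNl; lra.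
Qed.

Lemma dot_young (x y : V) : dot x y - th / 2 * dot x x <= dot y y / (2 * th).
Proof.
rewrite -subr_ge0.
rewrite (_ : _ - _ = dot (th *: x - y) (th *: x - y) / (2 * th)).
  by rewrite divr_ge0 ?dot_ge0// mulr_ge0// ltW.
by rewrite !dotE (dotC y x); field; rewrite gt_eqF.
Qed.

Lemma legendre_bound2 p q r : dot r q - H r <=
  dot p q - H p + dot (q - DH p) (q - DH p) / (2 * th).
Proof.
apply: (le_trans (legendre_bound p q r)).
by have := dot_young (r - p) (q - DH p); lra.
Qed.

Lemma has_sup_legendre q : has_sup (range (fun p => dot p q - H p)).
Proof.
split; first by exists (dot 0 q - H 0); exists 0.
exists (dot 0 q - H 0 + dot (q - DH 0) (q - DH 0) / (2 * th)).
by move=> _ [r _ <-]; exact: legendre_bound2.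
Qed.

Lemma legendre_ge p q : dot p q - H p <= L q.
Proof. by apply: sup_upper_bound; [exact: has_sup_legendre|exists p]. Qed.

Lemma legendre_le q c : (forall p, dot p q - H p <= c) -> L q <= c.
Proof.
move=> Hc; apply: ge_sup; first by exists (dot 0 q - H 0); exists 0.
by move=> _ [p _ <-].
Qed.

(** Strong convexity of [H] dualises to a quadratic upper bound for its
    transform at the slope [DH p]. *)
Lemma legendre_upper p q :
  L q <= dot p q - H p + dot (q - DH p) (q - DH p) / (2 * th).
Proof. by apply: legendre_le => r; exact: legendre_bound2. Qed.

Lemma legendre_DH p : L (DH p) = dot p (DH p) - H p.
Proof.
apply/eqP; rewrite eq_le legendre_ge andbT.
by apply: (le_trans (legendre_upper p _)); rewrite subrr dot0l mul0r addr0.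
Qed.

(** The weights are travel times, so they are not normalised to have sum 1. *)
Lemma legendre_convex (s t : R) a b c : 0 <= s -> 0 <= t -> 0 < s + t ->
  (s + t) *: c = s *: a + t *: b -> (s + t) * L c <= s * L a + t * L b.
Proof.
move=> s0 t0 st0 E; rewrite -ler_pdivlMl//; apply: legendre_le => p.
rewrite ler_pdivlMl// mulrBr -dotZr E !dotE.
have A : s * (dot p a - H p) <= s * L a by rewrite ler_wpM2l// legendre_ge.
have B : t * (dot p b - H p) <= t * L b by rewrite ler_wpM2l// legendre_ge.
lra.
Qed.

End Legendre.

Section Directions.
Context {R : realType}.

Lemma derive_le_of (V : normedModType R) (f : V -> R) z v c :
  derivable f z v ->
  (exists2 r : R, 0 < r & forall h, 0 < h < r -> f (z + h *: v) - f z <= h * c) ->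
  'D_v f z <= c.
Proof.
move=> df [r r0 Hr]; apply/ler_addgt0Pr => e e0.
have [s s0 Hs] := derivable_expand df e0.
pose h := Num.min r s / 2.
have m0 : 0 < Num.min r s by rewrite lt_min r0.
have h0 : 0 < h by rewrite divr_gt0.
have hm : h < Num.min r s by rewrite ltr_pdivrMr// ltr_pMr// ltr1n.
move: hm; rewrite lt_min => /andP[hr hs].
have := Hs h; rewrite gtr0_norm// => /(_ hs); rewrite ler_norml => /andP[A _].
have := Hr h; rewrite h0 hr => /(_ isT) B.
rewrite -(ler_pM2l h0); nra.
Qed.

Lemma derive_ge_of (V : normedModType R) (f : V -> R) z v c :
  derivable f z v ->
  (exists2 r : R, 0 < r & forall h, 0 < h < r -> h * c <= f (z + h *: v) - f z) ->
  c <= 'D_v f z.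
Proof.
move=> df [r r0 Hr]; apply/ler_addgt0Pr => e e0.
have [s s0 Hs] := derivable_expand df e0.
pose h := Num.min r s / 2.
have m0 : 0 < Num.min r s by rewrite lt_min r0.
have h0 : 0 < h by rewrite divr_gt0.
have hm : h < Num.min r s by rewrite ltr_pdivrMr// ltr_pMr// ltr1n.
move: hm; rewrite lt_min => /andP[hr hs].
have := Hs h; rewrite gtr0_norm// => /(_ hs); rewrite ler_norml => /andP[_ A].
have := Hr h; rewrite h0 hr => /(_ isT) B.
rewrite -(ler_pM2l h0); nra.
Qed.

Variable d : nat.
Local Notation V := 'rV[R]_d.

Lemma open_open_half : open (@open_half R d).
Proof.
rewrite openE => z z0; exact: near_time_gt0.
Qed.

Lemma derive_fst (phi : V * R -> R) x t e :
  'D_((e, 0) : V * R) phi (x, t) = 'D_e (fun y => phi (y, t)) x.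
Proof.
rewrite /derive (_ : (fun h : R => _) = (fun h : R => h^-1 *:
  (((fun y => phi (y, t)) \o shift x) (h *: e) - phi (x, t))))//.
apply/funext => h /=; congr (_ *: (_ - _)).
apply: (congr1 (fun s => phi (_, s))).
exact: (etrans (congr1 (+%R^~ t) (mulr0 h)) (add0r t)).
Qed.

Lemma derive_snd (phi : V * R -> R) x t e :
  'D_((0, e) : V * R) phi (x, t) = 'D_e (fun s => phi (x, s)) t.
Proof.
rewrite /derive (_ : (fun h : R => _) = (fun h : R => h^-1 *:
  (((fun s => phi (x, s)) \o shift t) (h *: e) - phi (x, t))))//.
apply/funext => h /=; congr (_ *: (_ - _)).
apply: (congr1 (fun y => phi (y, _))).
exact: (etrans (congr1 (+%R^~ x) (scaler0 _ h)) (add0r x)).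
Qed.

(** The direction [(q, -1)] is that of a path of velocity [q] followed
    backwards in time. *)
Lemma derive_space_time (phi : V * R -> R) z q :
  Ck_on (@open_half R d) 1 phi -> 0 < z.2 ->
  'D_((q, -1) : V * R) phi z = dot q (space_grad phi z) - time_deriv phi z.
Proof.
move=> Cphi z0.
have E0 : ((q, -1) : V * R) =
    \sum_j q 0 j *: ((delta_mx 0 j, 0) : V * R) + (-1) *: ((0, 1) : V * R).
  have -> : \sum_j q 0 j *: ((delta_mx 0 j, 0) : V * R) = (q, 0).
    rewrite [in RHS](row_delta q).
    elim/big_ind2: _ => // [x y x' y' -> ->|j _].
      exact: (congr1 (pair _) (addr0 _)).
    exact: (congr1 (pair _) (mulr0 _)).
  apply: (@eq_trans _ _ (q + (-1) *: 0, 0 + (-1) * 1)) => //.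
  by rewrite scaler0 addr0 add0r mulr1.
rewrite E0 (derive_addv _ _ open_open_half Cphi z0).
rewrite (derive_sumv _ _ open_open_half Cphi z0) (deriveZ_C1 _ _ Cphi z0) mulN1r.
case: z z0 => x t /= _; congr (_ - _).
  by apply: eq_bigr => j _; rewrite mxE derive_fst.
by rewrite /time_deriv derive1E derive_snd.
Qed.

End Directions.

Section HopfLax.
Context {R : realType} {d : nat}.
Local Notation V := 'rV[R]_d.

Lemma BUC_bounds (u : V * R -> R) : BUC (@closed_half R d) u ->
  (exists2 M : R, 0 <= M & forall z, 0 <= z.2 -> `|u z| <= M) /\
  (forall e, 0 < e -> exists2 r : R, 0 < r & forall z1 z2 : V * R,
    0 <= z1.2 -> 0 <= z2.2 -> `|z1.1 - z2.1| < r -> `|z1.2 - z2.2| < r ->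
    `|u z1 - u z2| < e).
Proof.
move=> [bu cu]; split.
  have /pinfty_ex_gt0[M M0 HM] := bu.
  by exists M; [exact: ltW|move=> z z0; exact: HM].
move=> e e0; have [r r0 Hr] := (unif_continuousP _).1 cu e e0.
exists r => // z1 z2 z10 z20 H1 H2.
have := Hr (z2, z1); rewrite /= ball_subspace_ball /subspace_ball /=.
rewrite mem_set//= => Huz.
have : ball z2 r z1 by rewrite prod_norm_ball /= prod_normE /= gt_max distrC H1 distrC.
by move=> /(conj z10)/Huz; rewrite -ball_normE /= distrC.
Qed.

Variables (H : V -> R) (DH : V -> V) (th : R).
Hypotheses (th0 : 0 < th) (HSC : strongly_convex H DH th).
Hypothesis (cH : continuous H).
Local Notation L := (legendre H).

Variable u : V * R -> R.
Hypothesis BUCu : BUC (@closed_half R d) u.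

(** The value obtained from [x] by moving for the time [t] at the constant
    velocity [q], at the cost [L q] per unit of time, and collecting the
    initial datum there. *)
Definition travel (q : V) (z : V * R) : R :=
  u (z.1 + z.2 *: q, 0) - z.2 * L q.

Definition hopf_lax (z : V * R) : R := sup (range (travel^~ z)).

Lemma legendre_ge0 q : - H 0 <= L q.
Proof. by have := legendre_ge th0 HSC 0 q; rewrite dot0l sub0r. Qed.

Lemma travel_ub M z q : (forall z, 0 <= z.2 -> `|u z| <= M) -> 0 <= z.2 ->
  travel q z <= M + z.2 * H 0.
Proof.
move=> HM z0; rewrite /travel.
have := HM (z.1 + z.2 *: q, 0) (lexx 0); rewrite ler_norml => /andP[_ A].
have := ler_wpM2l z0 (legendre_ge0 q); rewrite mulrN; lra.
Qed.

Lemma has_sup_travel z : 0 <= z.2 -> has_sup (range (travel^~ z)).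
Proof.
move=> z0; have [[M M0 HM] _] := BUC_bounds BUCu.
split; first by exists (travel 0 z); exists 0.
by exists (M + z.2 * H 0) => _ [q _ <-]; exact: travel_ub.
Qed.

Lemma hopf_lax_ge q z : 0 <= z.2 -> travel q z <= hopf_lax z.
Proof. by move=> z0; apply: sup_upper_bound; [exact: has_sup_travel|exists q]. Qed.

Lemma hopf_lax_le z c : (forall q, travel q z <= c) -> hopf_lax z <= c.
Proof.
move=> Hc; apply: ge_sup; first by exists (travel 0 z); exists 0.
by move=> _ [q _ <-].
Qed.

Lemma hopf_lax_gt z c : c < hopf_lax z -> exists q, c < travel q z.
Proof.
move=> cz; apply: contrapT => Hn; move: cz; apply/negP; rewrite -leNgt.
apply: hopf_lax_le => q; rewrite leNgt; apply/negP => cq; apply: Hn; by exists q.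
Qed.

Lemma continuous_u0 : continuous (fun x => u (x, 0)).
Proof.
move=> x; apply/continuous_atP => e e0.
have [_ /(_ e e0)[r r0 Hr]] := BUC_bounds BUCu.
by exists r => // y yx; apply: Hr => //=; rewrite subrr normr0.
Qed.

Lemma continuous_travel q : continuous (travel q).
Proof.
move=> z; apply: cvgB.
  apply: (@continuous_comp _ _ _ (fun z : V * R => z.1 + z.2 *: q) (fun x => u (x, 0))).
    apply: cvgD; first exact: cvg_fst.
    by apply: cvgZ; [exact: cvg_snd|exact: cvg_cst].
  exact: continuous_u0.
by apply: cvgM; [exact: cvg_snd|exact: cvg_cst].
Qed.

Lemma usc_u : usc_half u /\ usc_half (- u).
Proof.
have [_ Hu] := BUC_bounds BUCu.
have key (z : V * R) (e : R) : 0 <= z.2 -> 0 < e ->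
    \forall y \near z, 0 <= y.2 -> `|u y - u z| < e.
  move=> z0 e0; have [r r0 Hr] := Hu _ e0.
  apply/near_normP; exists r => // y; rewrite prod_normE gt_max => /andP[A B] y0.
  exact: Hr.
split=> z z0 c zc.
  have e0 : 0 < c - u z by rewrite subr_gt0.
  apply: filterS (key z _ z0 e0) => y Hy /Hy; rewrite ltr_norml; lra.
have e0 : 0 < c - (- u z) by rewrite subr_gt0.
apply: filterS (key z _ z0 e0) => y Hy /Hy; rewrite ltr_norml => {}Hy.
by suff : - u y < c by []; lra.
Qed.

(** In the direction [(q, -1)] the function [travel q] grows exactly at the
    rate [L q]. A test function touching it from above thus satisfies [L q <=
    q . D phi - phi_t], and [q . p - L q <= H p]. *)
Lemma travel_subsolution q : viscosity_subsolution H (travel q).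
Proof.
move=> phi z Cphi z0 /near_normP[r r0 Hr].
have := legendre_ge th0 HSC (space_grad phi z) q.
have dphi : derivable phi z (q, -1) by exact: (Ck_on_derivable Cphi z0).
suff : L q <= 'D_((q, -1) : V * R) phi z.
  rewrite derive_space_time// dotC; lra.
apply: derive_ge_of => //; exists (r / (1 + `|(q, -1) : V * R|)).
  by rewrite divr_gt0// ltr_pwDl.
move=> h /andP[h0 hr].
have := Hr (z + h *: ((q, -1) : V * R)); rewrite addrC addKr normrZ gtr0_norm//.
have -> : h * `|(q, -1) : V * R| < r.
  move: hr; rewrite ltr_pdivlMr ?ltr_pwDl// => hr.
  by apply: le_lt_trans hr; rewrite ler_wpM2l ?(ltW h0)// lerDr.
move=> /(_ isT); rewrite addrC.
suff -> : travel q (z + h *: ((q, -1) : V * R)) = travel q z + h * L q by lra.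
rewrite /travel.
have -> : (z + h *: ((q, -1) : V * R)).1 + (z + h *: ((q, -1) : V * R)).2 *: q =
          z.1 + z.2 *: q.
  have -> : (z + h *: ((q, -1) : V * R)).2 = z.2 - h.
    by rewrite /= /GRing.scale/= mulrN1.
  by rewrite /= -addrA -scalerDl [h + _]addrC subrK.
have -> : (z + h *: ((q, -1) : V * R)).2 = z.2 - h.
  by rewrite /= /GRing.scale/= mulrN1.
ring.
Qed.

(** Moving at the velocity [q] first and then optimally is no better than
    moving at the average velocity, since [L] is convex. *)
Lemma hopf_lax_dpp z q h : 0 <= h -> h <= z.2 -> 0 < z.2 ->
  hopf_lax (z.1 + h *: q, z.2 - h) <= hopf_lax z + h * L q.
Proof.
move=> h0 hz z0; apply: hopf_lax_le => r.
pose c := z.2^-1 *: (h *: q + (z.2 - h) *: r).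
have Ec : z.2 *: c = h *: q + (z.2 - h) *: r.
  by rewrite /c scalerA divff ?scale1r// gt_eqF.
have zh0 : 0 <= z.2 - h by rewrite subr_ge0.
have Eh : h + (z.2 - h) = z.2 by ring.
have st0 : 0 < h + (z.2 - h) by rewrite Eh.
have E' : (h + (z.2 - h)) *: c = h *: q + (z.2 - h) *: r by rewrite Eh.
have := legendre_convex th0 HSC h0 zh0 st0 E'.
have := hopf_lax_ge c (ltW z0); rewrite Eh /travel /= Ec addrA; lra.
Qed.

(** The velocity [q = DH (D phi)] is the one for which [q . p - L q] reaches
    [H p]. *)
Lemma hopf_lax_supersolution : viscosity_supersolution H hopf_lax.
Proof.
move=> phi z Cphi z0 /near_normP[r r0 Hr].
set p := space_grad phi z; pose q := DH p.
have dphi : derivable phi z (q, -1) by exact: (Ck_on_derivable Cphi z0).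
suff : 'D_((q, -1) : V * R) phi z <= L q.
  rewrite derive_space_time// -/p (legendre_DH th0 HSC) dotC; lra.
have N0 : 0 < 1 + `|(q, -1) : V * R| by rewrite ltr_pwDl.
apply: derive_le_of => //; exists (Num.min z.2 (r / (1 + `|(q, -1) : V * R|))).
  by rewrite lt_min z0 divr_gt0.
move=> h; rewrite lt_min => /and3P[h0 hz hr].
have := Hr (z + h *: ((q, -1) : V * R)); rewrite addrC addKr normrZ gtr0_norm//.
have -> : h * `|(q, -1) : V * R| < r.
  move: hr; rewrite ltr_pdivlMr// => hr.
  by apply: le_lt_trans hr; rewrite ler_wpM2l ?(ltW h0)// lerDr.
move=> /(_ isT); rewrite addrC.
have -> : z + h *: ((q, -1) : V * R) = (z.1 + h *: q, z.2 - h).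
  by rewrite -[z.2 - h](congr1 (+%R z.2) (mulrN1 h)); case: (z).
have := hopf_lax_dpp q (ltW h0) (ltW hz) z0; lra.
Qed.

Hypothesis Hu : viscosity_solution H u.

Lemma solution_ge_travel q z : 0 <= z.2 -> travel q z <= u z.
Proof.
have [[M M0 HM] Hc] := BUC_bounds BUCu; have [_ usc_nu] := usc_u.
apply: (@comparison R d H (travel q) u M `|L q|) => //.
- exact: travel_subsolution.
- by have [] := Hu.
- move=> y y0; rewrite /travel.
  have := HM (y.1 + y.2 *: q, 0) (lexx 0); rewrite ler_norml => /andP[_ A].
  have : - (y.2 * L q) <= `|L q| * y.2.
    by rewrite -mulrN mulrC ler_wpM2r// ler_normr lexx orbT.
  lra.
- move=> y y0; have := HM y y0; rewrite ler_norml => /andP[A _].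
  have : 0 <= `|L q| * y.2 by rewrite mulr_ge0.
  lra.
- move=> y y0 c yc; have e0 : 0 < c - travel q y by rewrite subr_gt0.
  have /cvgrPdist_lt/(_ _ e0) := @continuous_travel q y.
  apply: filterS => y' + _; rewrite ltr_norml; lra.
move=> e e0.
have e2 : 0 < e / 2 by rewrite divr_gt0.
have [r r0 Hr] := Hc _ e2.
pose N := 1 + `|q| + `|L q|.
have N0 : 0 < N by rewrite /N ltr_pwDl// ltr_pwDl.
exists (Num.min (r / 2 / N) (e / 2 / N)).
  by rewrite lt_min !divr_gt0.
move=> z1 z2 /andP[t1 +] /andP[t2 +]; rewrite !lt_min => /andP[t1r t1e] /andP[t2r _].
move=> /andP[xr _].
have rN : r / 2 / N <= r / 2.
  by rewrite ler_pdivrMr// ler_peMr ?divr_ge0 ?(ltW r0)// /N -addrA lerDl addr_ge0.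
have q1 : z1.2 * N < r / 2 by rewrite -ltr_pdivlMr.
have q2 : z1.2 * N < e / 2 by rewrite -ltr_pdivlMr.
have s1 : 0 <= z1.2 * `|q| by rewrite mulr_ge0.
have s2 : 0 <= z1.2 * `|L q| by rewrite mulr_ge0.
have h1 : `|z1.1 + z1.2 *: q - z2.1| < r.
  rewrite addrAC (le_lt_trans (ler_normD _ _))// normrZ (ger0_norm t1).
  by move: q1; rewrite /N; lra.
have h2 : `|0 - z2.2| < r.
  by rewrite sub0r normrN (ger0_norm t2); lra.
have := Hr (z1.1 + z1.2 *: q, 0) z2 (lexx 0) t2 h1 h2.
rewrite ltr_norml /travel => /andP[_ A].
have : - (z1.2 * L q) <= z1.2 * `|L q|.
  by rewrite -mulrN ler_wpM2l// ler_normr lexx orbT.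
move: q2; rewrite /N; lra.
Qed.

Lemma solution_le_hopf_lax z : 0 <= z.2 -> u z <= hopf_lax z.
Proof.
have [[M M0 HM] Hc] := BUC_bounds BUCu; have [uscu _] := usc_u.
have low y : 0 <= y.2 -> u (y.1, 0) - y.2 * L 0 <= hopf_lax y.
  by move=> y0; have := hopf_lax_ge 0 y0; rewrite /travel scaler0 addr0.
apply: (@comparison R d H u hopf_lax M `|L 0|) => //.
- by have [] := Hu.
- exact: hopf_lax_supersolution.
- move=> y y0; have := HM y y0; rewrite ler_norml => /andP[_ A].
  have : 0 <= `|L 0| * y.2 by rewrite mulr_ge0.
  lra.
- move=> y y0; apply: le_trans (low y y0).
  have := HM (y.1, 0) (lexx 0); rewrite ler_norml => /andP[A _].
  have : y.2 * L 0 <= `|L 0| * y.2 by rewrite mulrC ler_wpM2r// ler_norm.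
  lra.
- move=> y y0 c yc; have : - hopf_lax y < c by [].
  rewrite ltrNl => /hopf_lax_gt[q Hq].
  have e0 : 0 < travel q y - - c by rewrite subr_gt0.
  have /cvgrPdist_lt/(_ _ e0) := @continuous_travel q y.
  apply: filterS => y' + y'0; rewrite ltr_norml => Hy.
  by suff : - hopf_lax y' < c by []; have := hopf_lax_ge q y'0; lra.
move=> e e0.
have e2 : 0 < e / 2 by rewrite divr_gt0.
have [r r0 Hr] := Hc _ e2.
pose N := 1 + `|L 0|.
have N0 : 0 < N by rewrite /N ltr_pwDl.
exists (Num.min r (e / 2 / N)); first by rewrite lt_min r0 !divr_gt0.
move=> z1 z2 /andP[t1 +] /andP[t2 +]; rewrite !lt_min => /andP[t1r _] /andP[t2r t2e].
move=> /andP[xr _].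
have q2 : z2.2 * N < e / 2 by rewrite -ltr_pdivlMr.
have h2 : `|z1.2 - 0| < r by rewrite subr0 (ger0_norm t1).
have := Hr z1 (z2.1, 0) t1 (lexx 0) xr h2; rewrite ltr_norml => /andP[_ A].
have := low z2 t2.
have : z2.2 * L 0 <= z2.2 * `|L 0| by rewrite ler_wpM2l// ler_norm.
move: q2; rewrite /N; lra.
Qed.

End HopfLax.

Section Relation.
Context {R : realType} {d : nat}.
Local Notation V := 'rV[R]_d.

(** The supremum of [u0 y - t L ((y - x) / t)] over [y] is [ut x]. It is
    stated through near-maximisers, so that it need not be attained. *)
Definition sup_convolution (L : V -> R) (t : R) (u0 ut : V -> R) :=
  (forall x y, u0 y - t * L (t^-1 *: (y - x)) <= ut x) /\
  (forall x c, c < ut x -> exists y, c < u0 y - t * L (t^-1 *: (y - x))).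

Theorem solution_sup_convolution (H : V -> R) DH (th : R) u (t : R) :
  0 < th -> strongly_convex H DH th -> continuous H ->
  BUC (@closed_half R d) u -> viscosity_solution H u -> 0 < t ->
  sup_convolution (legendre H) t (fun x => u (x, 0)) (fun x => u (x, t)).
Proof.
move=> th0 HSC cH Bu Hu t0.
have Ey (x y : V) : x + t *: (t^-1 *: (y - x)) = y.
  by rewrite scalerA divff ?gt_eqF// scale1r addrC subrK.
split=> [x y|x c cu].
  have := solution_ge_travel th0 HSC cH Bu Hu (t^-1 *: (y - x)) (z := (x, t)).
  by rewrite /travel /= Ey; apply; exact: ltW.
have Hle := solution_le_hopf_lax th0 HSC cH Bu Hu (z := (x, t)) (ltW t0).
have [q Hq] := hopf_lax_gt (lt_le_trans cu Hle).
exists (x + t *: q).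
have -> : t^-1 *: (x + t *: q - x) = q.
  by rewrite [x + _]addrC addrK scalerA mulVf ?gt_eqF// scale1r.
exact: Hq.
Qed.

End Relation.

(** * Second-order tests at one point *)

Lemma eq_le_normr (R : realType) (a b : R) : a = b -> `|a| <= `|b|.
Proof. by move=> ->. Qed.

Section LocalTest.
Context {R : realType} {d : nat}.
Local Notation V := 'rV[R]_d.

Lemma uniformly_convex_strongly (H : V -> R) : Ck_on setT 2 H ->
  uniformly_convex H ->
  exists2 th : R, 0 < th & strongly_convex H (grad H) th.
Proof.
move=> CH [th [Th [th0 _ Hth]]]; exists th => // p q.
have := @taylor2_ge _ _ H p (q - p) (th * dot (q - p) (q - p)) CH _.
rewrite (derive_grad _ _ (Ck_on_C1 CH)) [p + _]addrC subrK => /(_ _)/(le_trans _).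
have -> : th * dot (q - p) (q - p) / 2 = th / 2 * dot (q - p) (q - p) by field.
apply => // s _; rewrite derive2_hess//.
by have [A _] := Hth (p + s *: (q - p)); have := A (q - p); rewrite qform_scalar.
Qed.

(** The quadratic polynomial with value [c], gradient [p] and Hessian [B] at
    [z], bent downwards by a quartic term. *)
Definition quartic (c K : R) (z p : V) (B : 'M[R]_d) (x : V) : R :=
  c + dot (x - z) p + 2^-1 * dot ((x - z) *m B) (x - z)
  + - K * (dot (x - z) (x - z) * dot (x - z) (x - z)).

Lemma smooth_coordB (z : V) j : smooth (fun x : V => (x - z) 0 j).
Proof.
apply: (@smooth_affine _ _ _ (fun x : V => x 0 j)); last first.
  by move=> x v h; rewrite !mxE; ring.
move=> x; rewrite (_ : (fun _ => _) = (fun x : V => x 0 j - z 0 j)).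
  by apply: continuousB; [exact: coord_continuous|exact: cst_continuous].
by apply/funext => y; rewrite !mxE.
Qed.

Lemma smooth_dot (f g : V -> V) : (forall j, smooth (fun x => f x 0 j)) ->
  (forall j, smooth (fun x => g x 0 j)) -> smooth (fun x => dot (f x) (g x)).
Proof. by move=> sf sg; apply: smooth_sum => j; exact: smooth_mul. Qed.

Lemma smooth_quartic c K z p B : smooth (quartic c K z p B).
Proof.
have s1 := smooth_coordB z.
have s2 : smooth (fun x : V => dot (x - z) (x - z)) by exact: smooth_dot.
have s3 j : smooth (fun x => ((x - z) *m B) 0 j).
  rewrite (_ : (fun _ => _) = (fun x => \sum_i (x - z) 0 i * B i j)).
    by apply: smooth_sum => i; apply: smooth_mul => //; exact: smooth_cst.
  by apply/funext => x; rewrite mxE.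
apply: smooth_add; [apply: smooth_add; [apply: smooth_add|]|].
- exact: smooth_cst.
- by apply: smooth_dot => // j; exact: smooth_cst.
- by apply: smooth_mul; [exact: smooth_cst|exact: smooth_dot].
- by apply: smooth_mul; [exact: smooth_cst|exact: smooth_mul].
Qed.

Lemma quartic_derive c K z p B (x w : V) : B^T = B ->
  'D_w (quartic c K z p B) x = dot p w + dot ((x - z) *m B) w
    - 4 * K * dot (x - z) (x - z) * dot (x - z) w.
Proof.
move=> Bs.
have d1 : is_derive x w (fun x => dot (x - z) p) (dot p w).
  apply: (is_derive_expand (M := 0)) => h _.
  rewrite (_ : x + _ - z = x - z + h *: w); last by rewrite addrAC.
  by move: (x - z) => y; rewrite !dotE (dotC p) (_ : _ - _ - _ = 0) ?normr0 ?mul0r//; ring.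
have d2 : is_derive x w (fun x => dot ((x - z) *m B) (x - z))
    (2 * dot ((x - z) *m B) w).
  apply: (is_derive_expand (M := `|dot (w *m B) w|)) => h _.
  rewrite (_ : x + _ - z = x - z + h *: w); last by rewrite addrAC.
  move: (x - z) => y; rewrite mulmxDl -scalemxAl !dotE.
  rewrite (dot_mulmx w y) Bs (dotC w (y *m B)) -[h ^+ 2]ger0_norm ?sqr_ge0// -normrM.
  by apply: eq_le_normr; ring.
have d3 : is_derive x w (fun x => dot (x - z) (x - z)) (2 * dot (x - z) w).
  apply: (is_derive_expand (M := `|dot w w|)) => h _.
  rewrite (_ : x + _ - z = x - z + h *: w); last by rewrite addrAC.
  move: (x - z) => y; rewrite !dotE.
  rewrite (dotC w y) -[h ^+ 2]ger0_norm ?sqr_ge0// -normrM.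
  by apply: eq_le_normr; ring.
have -> : quartic c K z p B = cst c + (fun x => dot (x - z) p)
    + 2^-1 \*: (fun x => dot ((x - z) *m B) (x - z))
    + (- K) \*: ((fun x => dot (x - z) (x - z)) * (fun x => dot (x - z) (x - z))).
  by [].
have D := is_deriveD (is_deriveD (is_deriveD (is_derive_cst c x w) d1)
  (is_deriveZ 2^-1 d2)) (is_deriveZ (- K) (is_deriveM d3 d3)).
apply: (etrans (@derive_val _ _ _ _ _ _ _ D)).
by rewrite /GRing.scale/=; field.
Qed.

Lemma quartic_grad c K z p B : B^T = B -> grad (quartic c K z p B) z = p.
Proof.
move=> Bs; apply/rowP => j.
rewrite mxE quartic_derive// subrr mul0mx !dot0l dot_deltar; ring.
Qed.

Lemma quartic_hess c K z p B : B^T = B -> hess (quartic c K z p B) z = B.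
Proof.
move=> Bs; apply/matrixP => i j; rewrite mxE.
set ei := delta_mx 0 i; set ej := delta_mx 0 j.
suff D : is_derive z ei (fun y => 'D_ej (quartic c K z p B) y) (B i j).
  by rewrite (@derive_val _ _ _ _ _ _ _ D).
have E : dot (ei *m B) ej = B i j by rewrite dot_deltar -rowE mxE.
apply: (is_derive_expand (M := `|4 * K * dot ei ei * dot ei ej|)) => h h1.
rewrite !quartic_derive// subrr mul0mx !dot0l [z + _]addrC addrK -scalemxAl !dotE E.
rewrite (_ : _ - _ - _ = - (4 * K * dot ei ei * dot ei ej) * (h * h ^+ 2)).
  rewrite normrM normrN ler_wpM2l// normrM (ger0_norm (sqr_ge0 h)).
  by rewrite ler_piMl// sqr_ge0.
ring.
Qed.

(** Touching from below by a quadratic polynomial near [z] is enough: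
    subtracting a large multiple of the fourth power of the distance to [z]
    makes the contact global when [v] is bounded below, and changes neither
    the gradient nor the Hessian at [z]. *)
Lemma viscosity_mxge_local F v (C M0 : R) z p (B : 'M[R]_d) :
  viscosity_mxge F v C -> (forall x, - M0 <= v x) -> B^T = B ->
  (exists2 r : R, 0 < r & forall x, `|x - z| < r ->
    v z + dot (x - z) p + 2^-1 * qform B (x - z) <= v x) ->
  forall y, qform (F p *m B *m F p) y <= C * dot y y.
Proof.
move=> Fv vM Bs [r r0 Hr] y.
have [b b0 Hb] := qform_ub B.
pose c0 := `|v z + 2^-1 * dot p p + M0|.
pose c1 := 2^-1 + b / 2.
have c10 : 0 <= c1 by rewrite addr_ge0 ?divr_ge0// invr_ge0.
pose K := c0 / r ^+ 4 + c1 / r ^+ 2.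
have r20 : 0 < r ^+ 2 by rewrite exprn_gt0.
have r40 : 0 < r ^+ 4 by rewrite exprn_gt0.
have K0 : 0 <= K by rewrite addr_ge0// divr_ge0 ?(ltW r20) ?(ltW r40)// normr_ge0.
have := Fv (quartic (v z) K z p B) z (@smooth_quartic _ _ _ _ _) _.
rewrite quartic_grad// quartic_hess// => /(_ _)/(_ y).
rewrite qform_scalar qformN mulNr lerN2; apply => x.
have -> : v z - quartic (v z) K z p B z = 0.
  by rewrite /quartic subrr mul0mx !dot0l !mulr0; ring.
rewrite subr_ge0 /quartic -qform_bilin.
set w := x - z; set rho := dot w w.
have rho0 : 0 <= rho by exact: dot_ge0.
have [wr|wr] := ltP `|w| r.
  apply: le_trans (Hr x wr); rewrite -/w mulNr gerBl.
  by rewrite mulr_ge0// mulr_ge0.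
have rr : r ^+ 2 <= rho.
  apply: le_trans (sqr_norm_le_dot w); rewrite lerXn2r ?nnegrE//.
  exact: ltW.
have q1 : c0 <= c0 / r ^+ 4 * (rho * rho).
  rewrite mulrAC ler_pdivlMr// ler_wpM2l ?normr_ge0//.
  by rewrite (_ : r ^+ 4 = r ^+ 2 * r ^+ 2) ?ler_pM ?(ltW r20)//; ring.
have q2 : c1 * rho <= c1 / r ^+ 2 * (rho * rho).
  rewrite mulrAC ler_pdivlMr// -mulrA ler_wpM2l// ler_wpM2l//.
have q3 : v z + 2^-1 * dot p p + M0 <= c0 by exact: ler_norm.
have q4 := dot_le w p.
have q5 : qform B w <= b * rho by apply: le_trans (ler_norm _) (Hb w).
have q6 := vM x.
rewrite -/rho -mulr_natl in q4; move: q1 q2 q3 q4 q5 q6; rewrite /K /c1.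
lra.
Qed.

End LocalTest.

(** * The quadratic case *)

Section Quadratic.
Context {R : realType} {d : nat}.
Local Notation V := 'rV[R]_d.

Definition semiconcave (v : V -> R) (C : R) :=
  forall x e, (v (x + e) + v (x - e)) / 2 - C / 2 * dot e e <= v x.

(** The inequality D^2 v <= C in the viscosity sense, tested by quadratic
    polynomials. *)
Definition touch_bound (v : V -> R) (C : R) :=
  forall z p (B : 'M[R]_d), B^T = B ->
  (exists2 r : R, 0 < r & forall x, `|x - z| < r ->
    v z + dot (x - z) p + 2^-1 * qform B (x - z) <= v x) ->
  forall y, qform B y <= C * dot y y.

Lemma qform_rank1 (a b : R) (e h : V) :
  qform (a *: (e^T *m e) + b%:M) h = a * dot h e ^+ 2 + b * dot h h.
Proof.
rewrite qform_bilin mulmxDr mul_mx_scalar -scalemxAr mulmxA !dotE.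
have -> : h *m e^T = (dot h e)%:M.
  apply/matrixP => i j; rewrite !mxE !ord1 eqxx mulr1n.
  by apply: eq_bigr => k _; rewrite mxE.
by rewrite mul_scalar_mx dotZl (dotC e) expr2.
Qed.

(** If the chord inequality fails along [e], a quadratic function slightly
    more curved than [C] along [e] and very concave across [e] is slid below
    the graph over a tube around the segment. Its concavity across [e] keeps
    the contact point off the lateral face, and off the end faces except near
    the two end points, where the continuity of [v] takes over. The contact is
    thus interior, with a second derivative along [e] that exceeds [C]. *)
Lemma semiconcave_touch (v : V -> R) (C M0 : R) : continuous v ->
  (forall x, `|v x| <= M0) -> touch_bound v C -> semiconcave v C.
Proof.
move=> cv vM Hv y e; rewrite leNgt; apply/negP => gap.
pose E := dot e e.
have E0 : 0 < E.
  rewrite lt_neqAle dot_ge0 andbT; apply/eqP => EE.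
  have e0 : e = 0.
    apply/eqP; rewrite -normr_eq0 -sqrf_eq0; apply/eqP/le_anti.
    by rewrite sqr_ge0 (le_trans (sqr_norm_le_dot e))// -/E -EE.
  by move: gap; rewrite e0 dot0l addr0 subr0; lra.
pose g := (v (y + e) + v (y - e)) / 2 - C / 2 * E - v y.
have g0 : 0 < g by rewrite subr_gt0.
(* The increment of C is so small that half of the gap survives. *)
pose C' := C + g / E.
have C'E : C' * E = C * E + g by rewrite /C' mulrDl divfK// gt_eqF.
pose al := (v (y + e) + v (y - e)) / 2 - C' / 2 * E.
pose be := (v (y + e) - v (y - e)) / 2.
have aly : al = v y + g / 2.
  by move: C'E; rewrite /al /g; lra.
have M00 : 0 <= M0 by exact: le_trans (vM y).
have g2 : 0 < g / 2 by rewrite divr_gt0.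
have [r1 r10 Hr1] := (continuous_atP _ _).1 (cv (y + e)) _ g2.
have [r2 r20 Hr2] := (continuous_atP _ _).1 (cv (y - e)) _ g2.
pose r := Num.min r1 r2.
have r0 : 0 < r by rewrite lt_min r10.
(* The first term dominates the values of v and of the quadratic function on
   the lateral face, the second one the oscillation of v at distance at least
   r from the end points on the end faces. *)
pose m := 2 * (M0 + `|al| + `|be| + `|C' * E|) + 4 * M0 / r ^+ 2.
have m1 : 2 * (M0 + `|al| + `|be| + `|C' * E|) <= m.
  by rewrite lerDl divr_ge0 ?sqr_ge0// mulr_ge0.
have m2 : 4 * M0 <= m * r ^+ 2.
  rewrite -ler_pdivrMr ?exprn_gt0// lerDr.
  by rewrite mulr_ge0// !addr_ge0.
have m0 : 0 <= m by apply: le_trans m1; rewrite mulr_ge0// !addr_ge0.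
pose Q h := dot h h - dot h e ^+ 2 / E.
pose B : 'M[R]_d := ((C' + m) / E) *: (e^T *m e) + (- m)%:M.
have Bs : B^T = B.
  by rewrite /B linearD/= linearZ/= trmx_mul trmxK tr_scalar_mx.
have BQ h : qform B h = C' * (dot h e ^+ 2 / E) - m * Q h.
  by rewrite qform_rank1 /Q; field; rewrite gt_eqF.
pose q x := al + be / E * dot (x - y) e + 2^-1 * qform B (x - y).
pose K := [set x | `|dot (x - y) e| <= E /\ Q (x - y) <= 1].
have QE (h : V) (s : R) : s ^+ 2 = 1 -> dot h e = s * E ->
    Q h = dot (h - s *: e) (h - s *: e).
  move=> s2 he; rewrite /Q he exprMn s2 !dotE he (dotC e) he -/E.
  have sE : s * (s * E) = E by rewrite mulrA -expr2 s2 mul1r.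
  by rewrite ?mulrN !sE; field; rewrite gt_eqF.
have csub : continuous (fun x : V => x - y).
  by move=> x; apply: continuousB; [exact: cvg_id|exact: cst_continuous].
have cde : continuous (fun x : V => dot (x - y) e).
  by apply: continuous_dot => // x; exact: cst_continuous.
have cQ : continuous (fun x : V => Q (x - y)).
  apply: cont_sub; first exact: (continuous_dot csub csub).
  by apply: cont_mul; [apply: cont_mul; exact: cde|exact: cont_cst].
have cq : continuous q.
  have -> : q = (fun x => al + be / E * dot (x - y) e + 2^-1 *
     (C' * (dot (x - y) e ^+ 2 / E) - m * Q (x - y))).
    by apply/funext => x; rewrite /q BQ.
  apply: cont_add; first apply: cont_add; first exact: cont_cst.
    by apply: cont_mul; [exact: cont_cst|exact: cde].
  apply: cont_mul; [exact: cont_cst|apply: cont_sub; apply: cont_mul; try exact: cont_cst].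
    by apply: cont_mul; [apply: cont_mul; exact: cde|exact: cont_cst].
  exact: cQ.
have Ky : K y.
  by split; rewrite subrr /Q !dot0l ?normr0 ?(ltW E0)// expr0n mul0r subr0.
have cK : compact K.
  apply: bounded_closed_compact.
    exists (`|y| + 2 + E); split; first exact: num_real.
    move=> N HN x [Kx1 Kx2]; apply: le_trans (ltW HN).
    have -> : x = y + (x - y) by rewrite addrC subrK.
    apply: (le_trans (ler_normD _ _)); rewrite -addrA lerD2l.
    have := sqr_norm_le_dot (x - y).
    have : dot (x - y) e ^+ 2 / E <= E.
      rewrite ler_pdivrMr// -(real_normK (num_real _)) -expr2.
      by rewrite lerXn2r ?nnegrE// ltW.
    by move: Kx2; rewrite /Q; have := sqr_ge0 (`|x - y| - 1); rewrite sqrrB; lra.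
  have -> : K = [set x | `|dot (x - y) e| <= E] `&` [set x | Q (x - y) <= 1] by [].
  apply: closedI.
    have cn : continuous (fun x : V => `|dot (x - y) e|).
      by move=> x; exact: (continuous_comp (cde x) (@norm_continuous _ _ _)).
    have := @closed_comp _ _ (fun x : V => `|dot (x - y) e|) [set s | s <= E].
    by apply; [move=> x _; exact: cn|exact: closed_le].
  have := @closed_comp _ _ (fun x : V => Q (x - y)) [set s | s <= 1].
  by apply; [move=> x _; exact: cQ|exact: closed_le].
have [z /set_mem Kz zmin] : exists2 z, z \in K &
    forall x, x \in K -> v z - q z <= v x - q x.
  apply: EVT_min_rV => //; first by exists y.
  apply: continuous_subspaceT; apply: cont_sub; [exact: cv|exact: cq].
have zy : v z - q z <= - (g / 2).
  have := zmin y (mem_set Ky).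
  have -> : q y = al by rewrite /q subrr dot0l BQ /Q !dot0l expr0n /=; ring.
  by rewrite aly; lra.
have [Kz1 Kz2] := Kz.
have face (s : R) : s ^+ 2 = 1 -> v (y + s *: e) = al + C' / 2 * E + s * be ->
    (forall x, `|x - (y + s *: e)| < r -> `|v x - v (y + s *: e)| < g / 2) ->
    dot (z - y) e <> s * E.
  move=> s2 vs Hs dz; have Qz := QE _ _ s2 dz.
  have qz : q z = v (y + s *: e) - m / 2 * Q (z - y).
    by rewrite /q BQ vs dz exprMn s2; field; rewrite gt_eqF.
  set w := z - y - s *: e in Qz.
  have wE : z - (y + s *: e) = w by rewrite /w opprD addrA.
  have Q0 : 0 <= Q (z - y) by rewrite Qz; exact: dot_ge0.
  have mQ : 0 <= m / 2 * Q (z - y) by rewrite mulr_ge0// divr_ge0.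
  have [wr|wr] := ltP `|w| r.
    have := Hs z; rewrite wE => /(_ wr); rewrite ltr_norml => /andP[A _].
    by move: zy mQ A; rewrite qz; clear; lra.
  have rQ : r ^+ 2 <= Q (z - y).
    rewrite Qz; apply: le_trans (sqr_norm_le_dot w).
    by rewrite lerXn2r ?nnegrE ?(ltW r0).
  have : m / 2 * r ^+ 2 <= m / 2 * Q (z - y) by rewrite ler_wpM2l// divr_ge0.
  have := vM z; have := vM (y + s *: e); rewrite !ler_norml => /andP[_ A] /andP[A' _].
  by move: zy m2 g0 A A'; rewrite qz; clear; lra.
have lt1 : `|dot (z - y) e| < E.
  rewrite lt_neqAle Kz1 andbT; apply/eqP => dE.
  have [d0|/ltW d0] := leP 0 (dot (z - y) e).
    rewrite ger0_norm// in dE.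
    apply: (face 1); rewrite ?expr1n ?scale1r ?mul1r//.
      by rewrite /al /be; field.
    by move=> x xr; apply: Hr1; apply: lt_le_trans xr _; rewrite ge_min lexx.
  rewrite ler0_norm// in dE.
  apply: (face (-1)); rewrite ?sqrrN ?expr1n ?scaleN1r ?mulN1r//.
  - by rewrite /al /be; field.
  - by move=> x xr; apply: Hr2; apply: lt_le_trans xr _; rewrite ge_min lexx orbT.
  - by rewrite -dE opprK.
have lt2 : Q (z - y) < 1.
  rewrite lt_neqAle Kz2 andbT; apply/eqP => Q1.
  have b1 : be / E * dot (z - y) e <= `|be|.
    apply: (le_trans (ler_norm _)); rewrite normrM normrM normfV (gtr0_norm E0).
    by rewrite -mulrA ler_piMr// ler_pdivrMl// mulr1.
  have b2 : C' * (dot (z - y) e ^+ 2 / E) <= `|C' * E|.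
    have d2 : 0 <= dot (z - y) e ^+ 2 / E by rewrite divr_ge0 ?sqr_ge0// ltW.
    apply: (le_trans (ler_norm _)); rewrite normrM [leRHS]normrM ler_wpM2l//.
    rewrite (ger0_norm d2) (gtr0_norm E0) ler_pdivrMr//.
    rewrite -(real_normK (num_real (dot (z - y) e))) -expr2.
    by rewrite lerXn2r ?nnegrE// ltW.
  have := vM z; rewrite ler_norml => /andP[A _].
  move: zy; rewrite /q BQ Q1 mulr1.
  by move: b1 b2 m1 A g0 (ler_norm al) (normr_ge0 (C' * E)); clear; lra.
have [r3 r30 Hr3] : exists2 r, 0 < r & forall x, `|x - z| < r -> K x.
  have e1 : 0 < E - `|dot (z - y) e| by rewrite subr_gt0.
  have e2 : 0 < 1 - Q (z - y) by rewrite subr_gt0.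
  have [a a0 Ha] := (continuous_atP _ _).1 (cde z) _ e1.
  have [b b0 Hb] := (continuous_atP _ _).1 (cQ z) _ e2.
  exists (Num.min a b); first by rewrite lt_min a0.
  move=> x; rewrite lt_min => /andP[xa xb]; split.
    have := Ha x xa; have := ler_normD (dot (x - y) e - dot (z - y) e) (dot (z - y) e).
    by rewrite subrK; clear; lra.
  by have := Hb x xb; rewrite ltr_norml; clear; lra.
(* At the contact point z the quadratic function has this gradient and the
   Hessian B, with B(e, e) = C' |e|^2. *)
have := Hv z ((be / E) *: e + (z - y) *m B) B Bs _ e.
rewrite BQ /Q -/E => /(_ _); rewrite -/E.
have -> : C' * (E ^+ 2 / E) - m * (E - E ^+ 2 / E) = C' * E.
  by field; rewrite gt_eqF.
rewrite C'E => Hcontra.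
suff : C * E + g <= C * E by move: g0; clear; lra.
apply: Hcontra; exists r3 => // x /Hr3 Kx.
have := zmin x (mem_set Kx).
have -> : q x = q z + dot (x - z) ((be / E) *: e + (z - y) *m B)
    + 2^-1 * qform B (x - z).
  rewrite /q; have -> : x - y = (x - z) + (z - y) by rewrite addrA subrK.
  move: (x - z) (z - y) => h k.
  rewrite !qform_bilin mulmxDl !dotE (dot_mulmx h k) Bs (dotC (k *m B) h).
  by field; rewrite gt_eqF.
by clear; lra.
Qed.

End Quadratic.

Section QuadraticCase.
Context {R : realType} {d : nat}.
Local Notation V := 'rV[R]_d.

(** Nearly optimal points for [x + e] and [x - e] are taken, and their
    midpoint competes for [x]. The loss is a quadratic form in the defect [b],
    bounded below by completing the square. *)
Lemma semiconcave_sup_convolution (u0 ut : V -> R) (t C : R) :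
  0 < t -> 0 < C -> 0 < 1 - C * t ->
  (forall x y, u0 y - dot (y - x) (y - x) / (2 * t) <= ut x) ->
  (forall x c, c < ut x -> exists y, c < u0 y - dot (y - x) (y - x) / (2 * t)) ->
  semiconcave u0 C -> semiconcave ut (C / (1 - C * t)).
Proof.
move=> t0 C0 Ct0 Hge Hle Hu x e; apply/ler_addgt0Pr => ep ep0.
have [|y1 Hy1] := Hle (x + e) (ut (x + e) - ep); first by rewrite ltrBlDr ltrDl.
have [|y2 Hy2] := Hle (x - e) (ut (x - e) - ep); first by rewrite ltrBlDr ltrDl.
pose m := 2^-1 *: (y1 + y2) - x; pose b := 2^-1 *: (y1 - y2) - e.
have E1 : y1 = (x + m) + (e + b).
  by apply/rowP => j; rewrite !mxE; field.
have E2 : y2 = (x + m) - (e + b).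
  by apply/rowP => j; rewrite !mxE; field.
clearbody m b.
have D1 : y1 - (x + e) = m + b.
  by rewrite E1; apply/rowP => j; rewrite !mxE; ring.
have D2 : y2 - (x - e) = m - b.
  by rewrite E2; apply/rowP => j; rewrite !mxE; ring.
have A := Hu (x + m) (e + b); rewrite -E1 -E2 in A.
have B := Hge x (x + m); rewrite [x + m - x]addrAC subrr add0r in B.
rewrite D1 in Hy1; rewrite D2 in Hy2.
have sq : 0 <= dot b b / (2 * t) - C / 2 * dot (e + b) (e + b)
    + C / (1 - C * t) / 2 * dot e e.
  have -> : dot b b / (2 * t) - C / 2 * dot (e + b) (e + b)
    + C / (1 - C * t) / 2 * dot e e = (1 - C * t) / (2 * t) *
    dot (b - (C * t / (1 - C * t)) *: e) (b - (C * t / (1 - C * t)) *: e).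
    rewrite !(dotDl, dotDr, dotNl, dotNr, dotZl, dotZr) (dotC e b).
    by field; rewrite !gt_eqF.
  apply: mulr_ge0; last exact: dot_ge0.
  by apply: divr_ge0; [exact: ltW|apply: mulr_ge0 => //; exact: ltW].
have par : (dot (m + b) (m + b) / (2 * t) + dot (m - b) (m - b) / (2 * t)) / 2
    = dot m m / (2 * t) + dot b b / (2 * t).
  by rewrite !dotE (dotC b m); field; rewrite gt_eqF.
move: sq par A B Hy1 Hy2.
move: (dot (m + b) _ / _) (dot (m - b) _ / _) (dot m m / _) (dot b b / _) => a1 a2 a3 a4.
move: (C / (1 - C * t)) (dot (e + b) _) => K a5.
lra.
Qed.

Lemma mulmx_lipschitz (A : 'M[R]_d) :
  exists2 c : R, 0 < c & forall w : V, `|w *m A| <= c * `|w|.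
Proof.
exists (1 + \sum_i \sum_j `|A i j|).
  by rewrite ltr_pwDl// sumr_ge0// => i _; exact: sumr_ge0.
move=> w; apply: normr_row_le => [|j].
  by rewrite mulr_ge0// addr_ge0// sumr_ge0// => i _; exact: sumr_ge0.
rewrite mxE (le_trans (ler_norm_sum _ _ _))// mulrDl mul1r ler_wpDl//.
rewrite mulr_suml; apply: ler_sum => i _; rewrite normrM mulrC.
rewrite ler_pM ?normr_coord// (bigD1 j)//= lerDl; exact: sumr_ge0.
Qed.

Lemma continuous_comp_mulmx (v : V -> R) (A : 'M[R]_d) : continuous v ->
  continuous (fun x : V => v (x *m A)).
Proof.
have [c c0 Hc] := mulmx_lipschitz A.
move=> cv x; apply/continuous_atP => e e0.
have [r r0 Hr] := (continuous_atP _ _).1 (cv (x *m A)) _ e0.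
exists (r / c); first by rewrite divr_gt0.
move=> y; rewrite ltr_pdivlMr// mulrC => xy; apply: Hr.
by rewrite -mulmxBl (le_lt_trans (Hc _)).
Qed.

(** A quadratic polynomial with Hessian [B] touching [v (x S)] corresponds to
    one with Hessian [S^-1 B S^-1] touching [v]. *)
Lemma touch_bound_linear (v : V -> R) (S : 'M[R]_d) C M0 :
  S^T = S -> S \in unitmx -> (forall x, - M0 <= v x) ->
  viscosity_mxge (fun=> S) v C -> touch_bound (fun x => v (x *m S)) C.
Proof.
move=> St Su vM Hv z p B Bs [r r0 Hr] y.
have Tt : (invmx S)^T = invmx S by rewrite trmx_inv St.
have [c c0 Hc] := mulmx_lipschitz (invmx S).
have := viscosity_mxge_local (z := z *m S) (p := p *m invmx S)
  (B := invmx S *m B *m invmx S) Hv vM _ _ y.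
have -> : S *m (invmx S *m B *m invmx S) *m S = B.
  by rewrite !mulmxA mulmxV// mul1mx -mulmxA mulVmx// mulmx1.
apply.
  by rewrite !trmx_mul Tt Bs mulmxA.
exists (r / c); first by rewrite divr_gt0.
move=> x; rewrite ltr_pdivlMr// mulrC => xz.
have E : x *m invmx S - z = (x - z *m S) *m invmx S.
  by rewrite mulmxBl -[z *m S *m _]mulmxA mulmxV// mulmx1.
have := Hr (x *m invmx S); rewrite -[x *m invmx S *m S]mulmxA mulVmx// mulmx1 E.
by rewrite (le_lt_trans (Hc _))// => /(_ isT); rewrite dot_mulmx Tt qform_conj.
Qed.

(** The chord inequality for [v] along [y S] passes to the test function,
    whose second difference is given by its Taylor expansion. *)
Lemma semiconcave_viscosity (v : V -> R) (S : 'M[R]_d) K :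
  S^T = S -> S \in unitmx -> semiconcave (fun x => v (x *m S)) K ->
  viscosity_mxge (fun=> S) v K.
Proof.
move=> St Su Hv phi x0 sphi Hphi y.
rewrite qform_scalar qformN mulNr lerN2 qform_conj// -derive2_hess//.
set w := y *m S; apply/ler_addgt0Pr => e e0.
have [r r0 Hr] := taylor2_local x0 w (sphi 2%N) e0.
pose h := r / 2; have h0 : 0 < h by rewrite divr_gt0.
have hr : h < r by rewrite ltr_pdivrMr// ltr_pMr// ltr1n.
have T1 := Hr h; rewrite gtr0_norm// in T1; have {}T1 := T1 hr.
have T2 := Hr (- h); rewrite normrN gtr0_norm// sqrrN in T2; have {}T2 := T2 hr.
have := Hv (x0 *m invmx S) (h *: y).
rewrite mulmxDl mulmxBl -scalemxAl -/w -[x0 *m _ *m S]mulmxA mulVmx// mulmx1 !dotE.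
have A := Hphi (x0 + h *: w); have B := Hphi (x0 - h *: w).
rewrite scaleNr in T2; move: A B T1 T2.
set D := 'D_w ('D_w phi) x0; move=> A B T1 T2 Q.
rewrite -(ler_pM2l (exprn_gt0 2 h0)); move: Q; rewrite expr2 in T1 T2 *; nra.
Qed.

(** A quadratic form equals its second-order Taylor polynomial at every point,
    which is [quartic] with [K = 0]. *)
Lemma quadratic_hess (H : V -> R) (A : 'M[R]_d) : A^T = A ->
  (forall p, H p = qform A p) -> forall p, hess H p = 2 *: A.
Proof.
move=> At HA p.
have Bs : (2 *: A)^T = 2 *: A by rewrite linearZ/= At.
have -> : H = quartic (H p) 0 p (p *m (2 *: A)) (2 *: A); last exact: quartic_hess.
apply/funext => x; rewrite /quartic {1}(_ : x = (x - p) + p); last by rewrite subrK.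
move: (x - p) => h; rewrite !HA !qform_bilin mulmxDl -!scalemxAr !dotE.
rewrite (dot_mulmx p h) At (dotC p (h *m A)) (dotC h (p *m A)) (dot_mulmx p h).
by rewrite At (dotC p (h *m A)); field.
Qed.

Lemma legendre_quadratic (H : V -> R) (S : 'M[R]_d) :
  S^T = S -> S \in unitmx -> (forall p, H p = 2^-1 * dot (p *m S) (p *m S)) ->
  forall q, legendre H (q *m S) = 2^-1 * dot q q.
Proof.
move=> St Su HS q.
have le p : dot p (q *m S) - H p <= 2^-1 * dot q q.
  have := dot_le (p *m S) q; rewrite HS (dot_mulmx p q) St -mulr_natl; lra.
apply/eqP; rewrite eq_le; apply/andP; split.
  by apply: ge_sup; [exists (dot 0 (q *m S) - H 0); exists 0|move=> _ [p _ <-]].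
apply: sup_upper_bound.
  split; first by exists (dot 0 (q *m S) - H 0); exists 0.
  by exists (2^-1 * dot q q) => _ [p _ <-].
exists (q *m invmx S) => //.
rewrite HS dot_mulmx trmx_inv St -[q *m S *m _]mulmxA mulmxV// -mulmxA mulVmx// !mulmx1; lra.
Qed.

Theorem quadratic_case (H : V -> R) (C : R) (u : V * R -> R) (t : R) :
  Ck_on setT 2 H -> uniformly_convex H -> quadratic H -> 0 < C ->
  BUC (@closed_half R d) u -> viscosity_solution H u ->
  viscosity_mxge (fun p => sqrtmx (hess H p)) (fun x => u (x, 0)) C ->
  0 < t -> 0 < 1 - C * t ->
  viscosity_mxge (fun p => sqrtmx (hess H p)) (fun x => u (x, t)) (C / (1 - C * t)).
Proof.
move=> CH cvH [A [At _ HA]] C0 Bu Hu Hv t0 Ct0.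
have [th th0 HSC] := uniformly_convex_strongly CH cvH.
have cH := Ck_continuous CH.
have FE : (fun p => sqrtmx (hess H p)) = (fun=> sqrtmx (2 *: A)).
  by apply/funext => p; rewrite (quadratic_hess At HA).
rewrite FE in Hv *; rewrite /sqrtmx in Hv *.
case: xgetP Hv => [S _ [St Spos SS] Hv|_ _]; last first.
  (* Where sqrtmx takes its default value 0, the claim reads 0 <= K |y|^2. *)
  move=> phi x0 _ _ y; rewrite !mul0mx oppr0 qform_scalar qform_bilin mulmx0 dot0l.
  by rewrite mulNr oppr_le0 mulr_ge0 ?dot_ge0// divr_ge0// ltW.
have Su : S \in unitmx.
  rewrite -row_free_unit; apply: inj_row_free => x xS.
  apply/eqP; apply: contraT => /Spos; rewrite qform_bilin xS dot0l ltxx.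
  by [].
have HS p : H p = 2^-1 * dot (p *m S) (p *m S).
  by rewrite dot_mulmx St -mulmxA SS HA qform_bilin -scalemxAr dotZr (dotC p); field.
have [[M M0 HM] _] := BUC_bounds Bu.
have [Hge Hle] := solution_sup_convolution th0 HSC cH Bu Hu t0.
have LE (x y : V) : t * legendre H (t^-1 *: (y *m S - x *m S)) =
    dot (y - x) (y - x) / (2 * t).
  rewrite -mulmxBl scalemxAl (legendre_quadratic St Su HS) !dotE.
  by field; rewrite gt_eqF.
apply: (semiconcave_viscosity St Su).
apply: (semiconcave_sup_convolution t0 C0 Ct0 (u0 := fun x => u (x *m S, 0))).
- by move=> x y; rewrite -LE; exact: Hge.
- move=> x c /Hle[y Hy]; exists (y *m invmx S).
  by rewrite -LE -[y *m _ *m S]mulmxA mulVmx// mulmx1.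
apply: (@semiconcave_touch _ _ _ _ M).
- exact: continuous_comp_mulmx (continuous_u0 Bu).
- by move=> x; exact: HM.
apply: (touch_bound_linear (M0 := M) St Su _ Hv) => x.
by have := HM (x, 0) (lexx 0); rewrite ler_norml => /andP[].
Qed.

End QuadraticCase.

(** * The one-dimensional case *)

Section OneDimension.
Context {R : realType}.

(** The function [L] plays the role of the Legendre transform of a C^2 function
    with derivatives [G] and [G']. The hypotheses [Llower] and [Lupper] express
    that its second derivative at [G p] is [1 / G' p], without differentiating
    it. *)
Variables (L G G' : R -> R).
Hypothesis Lconvex : forall s t a b c : R, 0 <= s -> 0 <= t -> 0 < s + t ->
  (s + t) * c = s * a + t * b -> (s + t) * L c <= s * L a + t * L b.
Hypothesis Lsub : forall p q, L (G p) + p * (q - G p) <= L q.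
Hypothesis Lcont : continuous L.
Hypothesis Gsurj : forall q, exists p, G p = q.
Hypothesis G'gt0 : forall p, 0 < G' p.
Hypothesis Llower : forall p e, 0 < e -> exists2 r : R, 0 < r &
  forall s, `|s| < r -> L (G p) + p * s + s ^+ 2 / (2 * (G' p + e)) <= L (G p + s).
Hypothesis Lupper : forall p e, 0 < e -> e < G' p -> exists2 r : R, 0 < r &
  forall s, `|s| < r -> L (G p + s) <= L (G p) + p * s + s ^+ 2 / (2 * (G' p - e)).

(** The solutions of [H''(v') v'' = C]: the derivative of [L] is the inverse
    of [H'], so that [H'(v') = C (x - a)]. *)
Definition cone (C a c x : R) := L (C * (x - a)) / C + c.

(** The inequality [H''(v') v'' <= C] in the viscosity sense, tested by
    parabolas. *)
Definition touch_bound1 (v : R -> R) (C : R) := forall z p b : R,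
  (exists2 r : R, 0 < r & forall x, `|x - z| < r ->
     v z + p * (x - z) + b / 2 * (x - z) ^+ 2 <= v x) ->
  G' p * b <= C.

Definition above_cones (v : R -> R) (C : R) := forall a c y1 y y2 : R,
  y1 <= y <= y2 -> cone C a c y1 < v y1 -> cone C a c y2 < v y2 ->
  cone C a c y <= v y.

Lemma cone_continuous_slope C a c x : 0 < C ->
  {for C, continuous (fun C => cone C a c x)}.
Proof.
move=> C0; apply: cvgD; last exact: cvg_cst.
apply: cvgM; last by apply: cvgV; [rewrite gt_eqF|exact: cvg_id].
apply: (@continuous_comp _ _ _ (fun C : R => C * (x - a)) L); last exact: Lcont.
by apply: cvgM; [exact: cvg_id|exact: cvg_cst].
Qed.

Lemma cone_continuous C a c : continuous (cone C a c).
Proof.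
move=> x; apply: cvgD; last exact: cvg_cst.
apply: cvgM; last exact: cvg_cst.
apply: (@continuous_comp _ _ _ (fun x : R => C * (x - a)) L); last exact: Lcont.
by apply: cvgM; [exact: cvg_cst|apply: cvgB; [exact: cvg_id|exact: cvg_cst]].
Qed.

(** If the conclusion fails at [y], it still fails for a cone with a parameter
    [D] slightly above [C]. Slid below the graph of [v], this cone touches it
    at an interior point, where its curvature, read as [G' v'' = D], is too
    large. *)
Lemma touch_above_cones (v : R -> R) C : 0 < C -> continuous v ->
  touch_bound1 v C -> above_cones v C.
Proof.
move=> C0 cv Hv a c y1 y y2 /andP[yy1 yy2] H1 H2; rewrite leNgt; apply/negP => H3.
have lt1 : \forall D \near C, cone D a c y1 < v y1.
  exact: (cvgr_lt _ (@cone_continuous_slope C a c y1 C0) _ H1).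
have lt2 : \forall D \near C, cone D a c y2 < v y2.
  exact: (cvgr_lt _ (@cone_continuous_slope C a c y2 C0) _ H2).
have lt3 : \forall D \near C, v y < cone D a c y.
  exact: (cvgr_gt _ (@cone_continuous_slope C a c y C0) _ H3).
have [r0 r00 Hr0] := (@near_normP R _ C _).1 (filterI lt1 (filterI lt2 lt3)).
pose D := C + r0 / 2.
have DC : C < D by rewrite ltrDl divr_gt0.
have D0 : 0 < D by exact: lt_trans DC.
have [|d1 [d2 d3]] := Hr0 D.
  by rewrite /D addrC addKr gtr0_norm ?divr_gt0// ltr_pdivrMr// ltr_pMr// ltr1n.
have y12 : y1 <= y2 by exact: le_trans yy2.
have cf : {within `[y1, y2], continuous (fun x => v x - cone D a c x)}.
  apply: continuous_subspaceT => x.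
  by apply: cvgB; [exact: cv|exact: cone_continuous].
have [z zI zmin] := EVT_min y12 cf.
move: zI; rewrite in_itv/= => /andP[z1 z2].
have zy : v z - cone D a c z < 0.
  by apply: le_lt_trans (zmin y _) _; rewrite ?in_itv/= ?yy1// subr_lt0.
have {}z1 : y1 < z.
  by rewrite lt_neqAle z1 andbT; apply/eqP => E; move: zy d1; rewrite -E; lra.
have {}z2 : z < y2.
  by rewrite lt_neqAle z2 andbT; apply/eqP => E; move: zy d2; rewrite E; lra.
have [p Gp] := Gsurj (D * (z - a)).
(* With this margin, G' p * D / (G' p + e) = 2 C D / (C + D) > C. *)
pose e := G' p * (D - C) / (2 * C).
have gp := G'gt0 p.
have e0 : 0 < e by rewrite divr_gt0 ?mulr_gt0// subr_gt0.
have [r r0' Hr] := Llower p e0.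
have ge0 : 0 < G' p + e by rewrite addr_gt0.
have CD : G' p * (D / (G' p + e)) <= C.
  apply: (Hv z p); exists (Num.min (r / D) (Num.min (z - y1) (y2 - z))).
    by rewrite !lt_min divr_gt0// !subr_gt0 z1.
  move=> x; rewrite !lt_min ltr_pdivlMr// => /and3P[xr].
  rewrite !ltr_norml => /andP[x1 _] /andP[_ x2].
  have : v z - cone D a c z <= v x - cone D a c x.
    by apply: zmin; rewrite in_itv/=; apply/andP; split; lra.
  have := Hr (D * (x - z)); rewrite normrM gtr0_norm// mulrC => /(_ xr).
  have -> : G p + D * (x - z) = D * (x - a) by rewrite Gp; ring.
  rewrite Gp /cone => A.
  have {}A : L (D * (z - a)) / D + p * (x - z) + D / (G' p + e) / 2 * (x - z) ^+ 2
      <= L (D * (x - a)) / D.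
    rewrite ler_pdivlMr//; apply: le_trans A; rewrite le_eqVlt; apply/orP; left.
    by apply/eqP; field; rewrite !gt_eqF.
  lra.
move: CD; rewrite mulrA ler_pdivrMr// => CD.
have : G' p * D <= G' p * ((C + D) / 2).
  by apply: (le_trans CD); rewrite le_eqVlt; apply/orP; left; apply/eqP;
    rewrite /e; field; rewrite gt_eqF.
rewrite ler_pM2l//; lra.
Qed.

(** The function [L] has the slope [p] at [G p], and by convexity its slopes
    are smaller on the left of that point. *)
Lemma slope_left p al be : be <= al -> al <= G p -> L al - L be <= p * (al - be).
Proof.
move=> ba; rewrite le_eqVlt => /predU1P[->|aG].
  by have := Lsub p be; lra.
have [s0 t0] : 0 <= G p - al /\ 0 <= al - be by split; lra.
have st0 : 0 < (G p - al) + (al - be) by lra.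
have E : ((G p - al) + (al - be)) * al = (G p - al) * be + (al - be) * G p by ring.
have := Lconvex s0 t0 st0 E; have := Lsub p be => A B.
have : (al - be) * (L (G p) + p * (be - G p)) <= (al - be) * L be.
  by rewrite ler_wpM2l.
rewrite -(ler_pM2l st0); nra.
Qed.

Lemma slope_right p al be : al <= be -> G p <= al -> p * (be - al) <= L be - L al.
Proof.
move=> ab; rewrite le_eqVlt => /predU1P[<-|aG].
  by have := Lsub p be; lra.
have [s0 t0] : 0 <= al - G p /\ 0 <= be - al by split; lra.
have st0 : 0 < (al - G p) + (be - al) by lra.
have E : ((al - G p) + (be - al)) * al = (al - G p) * be + (be - al) * G p by ring.
have := Lconvex s0 t0 st0 E; have := Lsub p be => A B.
have : (be - al) * (L (G p) + p * (be - G p)) <= (be - al) * L be.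
  by rewrite ler_wpM2l.
rewrite -(ler_pM2l st0); nra.
Qed.

Variables (u0 ut : R -> R) (t C : R).
Hypotheses (t0 : 0 < t) (C0 : 0 < C) (Ct0 : 0 < 1 - C * t).
Hypothesis Hge : forall x y, u0 y - t * L ((y - x) / t) <= ut x.
Hypothesis Hle : forall x c, c < ut x -> exists y, c < u0 y - t * L ((y - x) / t).
Local Notation K := (C / (1 - C * t)).

(** Convexity of [L] with the weights [1 / K] and [t], whose sum is [1 / C].
    Equality holds on the characteristic [C (y - a) = K (x - a)], so the cones
    of parameter [C] evolve into those of parameter [K]. *)
Lemma cone_evolution a c x y : cone C a c y <= cone K a c x + t * L ((y - x) / t).
Proof.
have K0 : 0 < K by rewrite divr_gt0.
have s0 : 0 <= K^-1 by rewrite invr_ge0 ltW.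
have st0 : 0 < K^-1 + t by rewrite addr_gt0// invr_gt0.
have E : (K^-1 + t) * (C * (y - a)) = K^-1 * (K * (x - a)) + t * ((y - x) / t).
  by field; rewrite !gt_eqF.
have := Lconvex s0 (ltW t0) st0 E.
have -> : K^-1 + t = C^-1 by field; rewrite !gt_eqF.
rewrite /cone mulrC [K^-1 * _]mulrC; lra.
Qed.

(** Let [y1] and [y2] be nearly optimal for [x1] and [x2], and let [y0] be the
    point from which the cone reaches [x0]. If [y0] lies between them, [u0] is
    above the initial cone at [y0]. Otherwise the one of [y1], [y2] nearer to
    [y0] competes for [x0] instead, and the monotonicity of the slopes of [L]
    pays for the detour. This ordering argument is where dimension one is
    used. *)
Lemma above_cones_evolution p x1 x0 x2 a c :
  above_cones u0 C -> x1 < x0 -> x0 < x2 -> G p = K * (x0 - a) ->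
  cone K a c x1 < ut x1 -> cone K a c x2 < ut x2 -> cone K a c x0 <= ut x0.
Proof.
move=> Hu x10 x02 Gp /Hle[y1 Hy1] /Hle[y2 Hy2].
have K0 : 0 < K by rewrite divr_gt0.
pose y0 := a + G p / C.
have Ey0 : (y0 - x0) / t = G p.
  rewrite /y0 Gp; field; rewrite !gt_eqF//.
have Cy0 : C * (y0 - a) = G p.
  by rewrite /y0 addrC addKr mulrC divfK// gt_eqF.
have up1 := cone_evolution a c x1 y1; have up2 := cone_evolution a c x2 y2.
have grow x : cone K a c x0 + p * (x - x0) <= cone K a c x.
  have := Lsub p (K * (x - a)); rewrite {2}Gp -mulrBr opprB addrA subrK => A.
  rewrite /cone -Gp addrAC lerD2r ler_pdivlMr// mulrDl divfK ?gt_eqF//.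
  by apply: le_trans A; rewrite le_eqVlt; apply/orP; left; apply/eqP; ring.
(* The competitor is y2 if y2 < y0, then y1 if y0 < y1, and y0 itself in the
   remaining case. *)
have [lt20|le02] := ltP y2 y0.
  have := Hge x0 y2.
  have A : (y2 - x0) / t <= G p by rewrite -Ey0 ler_pdivrMr// divfK ?gt_eqF//; lra.
  have B : (y2 - x2) / t <= (y2 - x0) / t by rewrite ler_pM2r ?invr_gt0//; lra.
  have := slope_left B A; rewrite -mulrBl -(ler_pM2l t0).
  have -> : t * (p * ((y2 - x0 - (y2 - x2)) / t)) = p * (x2 - x0).
    by field; rewrite gt_eqF.
  have := grow x2; lra.
have [lt01|le10] := ltP y0 y1.
  have := Hge x0 y1.
  have A : G p <= (y1 - x0) / t by rewrite -Ey0 ler_pdivrMr// divfK ?gt_eqF//; lra.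
  have B : (y1 - x0) / t <= (y1 - x1) / t by rewrite ler_pM2r ?invr_gt0//; lra.
  have := slope_right B A; rewrite -mulrBl -(ler_pM2l t0).
  have -> : t * (p * ((y1 - x1 - (y1 - x0)) / t)) = p * (x0 - x1).
    by field; rewrite gt_eqF.
  have := grow x1; lra.
have := Hge x0 y0; rewrite Ey0.
have := Hu a c y1 y0 y2; rewrite le10 le02 => /(_ isT) Hy.
have {}Hy : cone C a c y0 <= u0 y0 by apply: Hy; lra.
move: Hy; rewrite /cone Cy0 -Gp.
have -> : L (G p) / K = L (G p) / C - t * L (G p) by field; rewrite !gt_eqF.
lra.
Qed.

(** Were the curvature at [z] too large, the cone through [z] with the same
    derivative would lie strictly below [ut] on both sides of [z]; a slightly
    higher cone then contradicts the preceding lemma. *)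
Lemma touch_evolution : above_cones u0 C -> touch_bound1 ut K.
Proof.
move=> Hu z p b [r r0 Hr]; rewrite leNgt; apply/negP => Kb.
have K0 : 0 < K by rewrite divr_gt0.
have g0 := G'gt0 p.
have b0 : 0 < b by rewrite -(pmulr_rgt0 _ g0); exact: lt_trans Kb.
(* The mean of G' p and K / b leaves room in K / (G' p - e) < b. *)
pose e := (G' p - K / b) / 2.
have Kb' : K / b < G' p by rewrite ltr_pdivrMr.
have Kb0 : 0 < K / b by rewrite divr_gt0.
have e0 : 0 < e by rewrite divr_gt0// subr_gt0.
have eG : e < G' p by rewrite /e; lra.
have ge : K / b < G' p - e by rewrite /e; lra.
have ge0 : 0 < G' p - e by exact: lt_trans ge.
have bK : K / (G' p - e) < b by rewrite ltr_pdivrMr// [b * _]mulrC -ltr_pdivrMr.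
have [s s0 Hs] := Lupper e0 eG.
pose a := z - G p / K.
have Gpa : G p = K * (z - a) by rewrite /a; field; rewrite ?gt_eqF.
pose c := ut z - L (G p) / K.
have cz : cone K a c z = ut z by rewrite /cone -Gpa /c addrC subrK.
pose m := Num.min r (s / K).
have m0 : 0 < m by rewrite lt_min r0 divr_gt0.
have below h : h != 0 -> `|h| < m -> cone K a c (z + h) < ut (z + h).
  rewrite lt_min ltr_pdivlMr// => h0 /andP[hr hs].
  have := Hr (z + h); rewrite addrC addKr => /(_ hr); rewrite addrC => A.
  have := Hs (h * K); rewrite normrM (gtr0_norm K0) => /(_ hs).
  have -> : G p + h * K = K * (z + h - a) by rewrite Gpa; ring.
  move=> B; apply: lt_le_trans A; rewrite -cz /cone -Gpa.
  have {}B : L (K * (z + h - a)) / K <=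
      L (G p) / K + p * h + K / (G' p - e) / 2 * h ^+ 2.
    rewrite ler_pdivrMr//; apply: le_trans B _.
    rewrite le_eqVlt; apply/orP; left; apply/eqP.
    by field; rewrite !gt_eqF.
  have : K / (G' p - e) / 2 * h ^+ 2 < b / 2 * h ^+ 2.
    by rewrite ltr_pM2r ?ltr_pM2r ?invr_gt0// exprn_even_gt0.
  lra.
pose h := m / 2.
have h0 : 0 < h by rewrite divr_gt0.
have hm : h < m by rewrite ltr_pdivrMr// ltr_pMr// ltr1n.
have B1 : cone K a c (z - h) < ut (z - h).
  by apply: below; rewrite ?oppr_eq0 ?gt_eqF// normrN gtr0_norm.
have B2 : cone K a c (z + h) < ut (z + h).
  by apply: below; rewrite ?gt_eqF// gtr0_norm.
pose eta := Num.min (ut (z - h) - cone K a c (z - h)) (ut (z + h) - cone K a c (z + h)) / 2.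
have mm : 0 < Num.min (ut (z - h) - cone K a c (z - h)) (ut (z + h) - cone K a c (z + h)).
  by rewrite lt_min !subr_gt0 B1.
have eta0 : 0 < eta by rewrite divr_gt0.
have etam : eta < Num.min (ut (z - h) - cone K a c (z - h)) (ut (z + h) - cone K a c (z + h)).
  by rewrite ltr_pdivrMr// ltr_pMr// ltr1n.
move: etam; rewrite lt_min => /andP[e1 e2].
have coneD x : cone K a (c + eta) x = cone K a c x + eta by rewrite /cone addrA.
have := @above_cones_evolution p (z - h) z (z + h) a (c + eta) Hu.
rewrite !coneD cz => /(_ _ _ Gpa) Hfin.
suff : ut z + eta <= ut z by rewrite gerDl leNgt eta0.
apply: Hfin; rewrite ?ltrDl ?ltrBlDr//.
- by rewrite ltrDl.
- by rewrite addrC -ltrBrDr.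
- by rewrite addrC -ltrBrDr.
Qed.

End OneDimension.

Section Line.
Context {R : realType}.
Local Notation V := 'rV[R]_1.
Local Notation pt s := (const_mx s : V).

Lemma row1E (x : V) : x = pt (x 0 0).
Proof. by apply/rowP => j; rewrite mxE ord1. Qed.

Lemma pt_add (a b : R) : pt (a + b) = pt a + pt b.
Proof. by apply/rowP => j; rewrite !mxE. Qed.

Lemma pt_sub (a b : R) : pt (a - b) = pt a - pt b.
Proof. by apply/rowP => j; rewrite !mxE. Qed.

Lemma pt_scale (a b : R) : a *: pt b = pt (a * b).
Proof. by apply/rowP => j; rewrite !mxE. Qed.

Lemma pt1 : pt 1 = delta_mx 0 0.
Proof. by apply/rowP => j; rewrite !mxE !ord1. Qed.

Lemma dot1 (x y : V) : dot x y = x 0 0 * y 0 0.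
Proof. by rewrite /dot big_ord1. Qed.

Lemma normr_pt (a : R) : `|pt a| = `|a|.
Proof.
apply/eqP; rewrite eq_le; apply/andP; split.
  by apply: normr_row_le => // j; rewrite mxE.
by have := normr_coord (pt a) 0; rewrite mxE.
Qed.

Lemma qform1 (A : 'M[R]_1) (x : V) : qform A x = A 0 0 * x 0 0 ^+ 2.
Proof. by rewrite qform_bilin dot1 mxE big_ord1; ring. Qed.

Lemma continuous_pt (f : V -> R) : continuous f -> continuous (fun s : R => f (pt s)).
Proof.
move=> cf s; apply/(@continuous_atP R R^o) => e e0.
have [r r0 Hr] := (continuous_atP _ _).1 (cf (pt s)) _ e0.
by exists r => // w ws; apply: Hr; rewrite -pt_sub normr_pt.
Qed.

Variables (H : V -> R) (th : R).
Hypotheses (CH : Ck_on setT 2 H) (th0 : 0 < th) (HSC : strongly_convex H (grad H) th).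
Let h s := H (pt s).
Let G s := 'D_(pt 1) H (pt s).
Let G' s := 'D_(pt 1) ('D_(pt 1) H) (pt s).
Let L q := legendre H (pt q).

Lemma gradE s : grad H (pt s) = pt (G s).
Proof. by apply/rowP => j; rewrite !mxE /G pt1 ord1. Qed.

Lemma hessE s : hess H (pt s) 0 0 = G' s.
Proof. by rewrite mxE /G' pt1. Qed.

Lemma strongly_convex1 a b : h a + (b - a) * G a + th / 2 * (b - a) ^+ 2 <= h b.
Proof. by have := HSC (pt a) (pt b); rewrite gradE -pt_sub !dot1 !mxE expr2. Qed.

Lemma G_mono a b : a <= b -> th * (b - a) <= G b - G a.
Proof.
rewrite le_eqVlt => /predU1P[->|ab]; first by rewrite !subrr mulr0.
have ba : 0 < b - a by rewrite subr_gt0.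
rewrite -(ler_pM2l ba); have := strongly_convex1 a b; have := strongly_convex1 b a.
rewrite -(opprB b a) sqrrN; nra.
Qed.

Lemma G_continuous : continuous G.
Proof.
have cf : continuous ('D_(pt 1) H).
  by apply: (@Ck_continuous _ _ 1); exact: Ck_on_derive.
exact: (continuous_pt cf).
Qed.

Lemma G_surj q : exists p, G p = q.
Proof.
pose B := `|q - G 0| / th.
have B0 : 0 <= B by rewrite divr_ge0// ltW.
have thB : th * B = `|q - G 0| by rewrite mulrC divfK// gt_eqF.
have m1 := G_mono B0; have B0' : - B <= 0 by rewrite oppr_le0.
have m2 := G_mono B0'; rewrite subr0 thB in m1; rewrite sub0r opprK thB in m2.
have BB : - B <= B by exact: le_trans B0.
have n1 := ler_norm (q - G 0); have n2 := ler_norm (- (q - G 0)).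
rewrite normrN in n2.
have cG : {within `[- B, B], continuous G}.
  by apply: continuous_subspaceT; exact: G_continuous.
have [|c _ <-] := @IVT R G (- B) B q BB cG; last by exists c.
by rewrite ge_min le_max; apply/andP; split; apply/orP; [left|right]; lra.
Qed.

Lemma hess_gt0 p : 0 < G' p.
Proof.
rewrite ltNge; apply/negP => Gp0.
have th2 : 0 < th / 2 by rewrite divr_gt0.
have [r r0 Hr] := taylor2_local_le (pt p) (pt 1) CH th2.
have hr : r / 2 < r by rewrite ltr_pdivrMr// ltr_pMr// ltr1n.
have h0 : 0 < r / 2 by rewrite divr_gt0.
have := Hr (r / 2); rewrite gtr0_norm// => /(_ hr).
rewrite -/(G p) -/(G' p) pt_scale mulr1 -pt_add -/(h p) -/(h _).
have := strongly_convex1 p (p + r / 2); rewrite [p + _ - p]addrAC subrr add0r.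
move: (r / 2) h0 => k k0.
have : 0 < k ^+ 2 * th by rewrite mulr_gt0// exprn_gt0.
have : 0 <= k ^+ 2 * - G' p by rewrite mulr_ge0 ?sqr_ge0// oppr_ge0.
lra.
Qed.

Lemma L_young p q : p * q - h p <= L q.
Proof. by have := legendre_ge th0 HSC (pt p) (pt q); rewrite dot1 !mxE. Qed.

Lemma L_le q c : (forall p, p * q - h p <= c) -> L q <= c.
Proof.
by move=> Hc; apply: legendre_le => x; rewrite (row1E x) dot1 !mxE; exact: Hc.
Qed.

Lemma L_G p : L (G p) = p * G p - h p.
Proof. by rewrite /L -gradE (legendre_DH th0 HSC) gradE dot1 !mxE. Qed.

Lemma L_sub p q : L (G p) + p * (q - G p) <= L q.
Proof. by have := L_young p q; rewrite L_G; lra. Qed.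

Lemma L_convex (s t a b c : R) : 0 <= s -> 0 <= t -> 0 < s + t ->
  (s + t) * c = s * a + t * b -> (s + t) * L c <= s * L a + t * L b.
Proof.
move=> s0 t0 st E; apply: (legendre_convex th0 HSC) => //.
by rewrite !pt_scale -pt_add E.
Qed.

(** The point [p + s / (G' p + e)], optimal for the osculating parabola of
    [H], is inserted into the supremum defining [L]. *)
Lemma L_lower p e : 0 < e -> exists2 r : R, 0 < r &
  forall s, `|s| < r -> L (G p) + p * s + s ^+ 2 / (2 * (G' p + e)) <= L (G p + s).
Proof.
move=> e0; have g0 := hess_gt0 p.
have [r r0 Hr] := taylor2_local_le (pt p) (pt 1) CH e0.
have ge0 : 0 < G' p + e by rewrite addr_gt0.
exists (r * (G' p + e)); first by rewrite mulr_gt0.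
move=> s sr; pose k := s / (G' p + e).
have kr : `|k| < r by rewrite normrM normfV (gtr0_norm ge0) ltr_pdivrMr.
have := Hr k kr.
rewrite -/(G p) -/(G' p) pt_scale mulr1 -pt_add -/(h p) -/(h _) => A.
apply: le_trans (L_young (p + k) (G p + s)); rewrite L_G.
have -> : s ^+ 2 / (2 * (G' p + e)) = k * s - k ^+ 2 / 2 * (G' p + e).
  by rewrite /k; field; rewrite gt_eqF.
lra.
Qed.

(** In the supremum defining [L], points near [p] are handled by the Taylor
    expansion of [H] and the others by its strong convexity. *)
Lemma L_upper p e : 0 < e -> e < G' p -> exists2 r : R, 0 < r &
  forall s, `|s| < r -> L (G p + s) <= L (G p) + p * s + s ^+ 2 / (2 * (G' p - e)).
Proof.
move=> e0 eg; have ge0 : 0 < G' p - e by rewrite subr_gt0.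
have [r r0 Hr] := taylor2_local (pt p) (pt 1) CH e0.
exists (th * r / 2); first by rewrite !mulr_gt0.
move=> s sr; apply: L_le => q; rewrite L_G.
have -> : q = p + (q - p) by rewrite addrC subrK.
move: (q - p) => k.
have [kr|kr] := ltP `|k| r.
  have := Hr k kr; rewrite -/(G p) -/(G' p) pt_scale mulr1 -pt_add -/(h p) -/(h _) => A.
  have : k * s - k ^+ 2 / 2 * (G' p - e) <= s ^+ 2 / (2 * (G' p - e)).
    rewrite -subr_ge0 (_ : _ - _ = (s - k * (G' p - e)) ^+ 2 / (2 * (G' p - e))).
      by rewrite divr_ge0 ?sqr_ge0// mulr_ge0// ltW.
    by field; rewrite gt_eqF.
  lra.
have A := strongly_convex1 p (p + k); rewrite [p + k - p]addrAC subrr add0r in A.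
have : k * s <= th / 2 * k ^+ 2.
  rewrite (le_trans (ler_norm _))// normrM -(real_normK (num_real k)) expr2 mulrCA.
  rewrite ler_wpM2l//.
  have : th * r <= th * `|k| by rewrite ler_pM2l.
  lra.
have : 0 <= s ^+ 2 / (2 * (G' p - e)).
  by rewrite divr_ge0 ?sqr_ge0// mulr_ge0// ltW.
lra.
Qed.

Lemma L_continuous : continuous L.
Proof.
move=> q; apply/(@continuous_atP R R^o) => e e0.
have [p <-] := G_surj q.
pose N := `|p| + 1 / (2 * th) + 1.
have thi : 0 <= 1 / (2 * th) by rewrite divr_ge0// mulr_ge0// ltW.
have N0 : 0 < N by rewrite ltr_wpDl// addr_ge0.
exists (Num.min 1 (e / N)); first by rewrite lt_min ltr01 divr_gt0.
move=> w; rewrite lt_min ltr_pdivlMr// => /andP[w1 we].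
have lo := L_sub p w.
have := legendre_upper th0 HSC (pt p) (pt w).
rewrite gradE -pt_sub !dot1 !mxE -/(L w) -/(h p) => up.
have {}up : L w <= L (G p) + p * (w - G p) + (w - G p) ^+ 2 * (1 / (2 * th)).
  by rewrite L_G expr2; apply: (le_trans up); rewrite le_eqVlt; apply/orP; left; apply/eqP; ring.
move: w1 we lo up; move: (w - G p) => k k1 ke lo up.
have a1 : - (`|p| * `|k|) <= p * k by rewrite -normrM lerNl -normrN ler_norm.
have a2 : p * k <= `|p| * `|k| by rewrite -normrM ler_norm.
have a3 : k ^+ 2 * (1 / (2 * th)) <= `|k| * (1 / (2 * th)).
  rewrite ler_wpM2r// -(real_normK (num_real k)) expr2 ler_piMr//; exact: ltW.
have a4 : 0 <= `|k| * (1 / (2 * th)) by rewrite mulr_ge0.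
move: ke; rewrite /N !mulrDr mulr1 => ke.
have kk := normr_ge0 k; rewrite ltr_norml; apply/andP; split; lra.
Qed.

Lemma sqrtmx1 (p : V) :
  sqrtmx (hess H p) 0 0 ^+ 2 = hess H p 0 0 /\ (sqrtmx (hess H p))^T = sqrtmx (hess H p).
Proof.
have g0 := hess_gt0 (p 0 0); rewrite -hessE -row1E in g0.
rewrite /sqrtmx; case: xgetP => [S _ [St _ <-]|Hn].
  by split => //; rewrite mxE big_ord1.
exfalso; have [] := Hn (Num.sqrt (hess H p 0 0))%:M; split.
- exact: tr_scalar_mx.
- move=> x x0; rewrite qform1 mxE eqxx mulr1n mulr_gt0 ?sqrtr_gt0//.
  rewrite exprn_even_gt0//=; apply: contra x0 => /eqP x0.
  by rewrite (row1E x) x0; apply/eqP/rowP => j; rewrite !mxE.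
- rewrite -scalar_mxM -expr2 sqr_sqrtr ?(ltW g0)//.
  by rewrite [RHS]mx11_scalar.
Qed.

Lemma sqrtmx_conj (p : V) (B : 'M[R]_1) :
  (sqrtmx (hess H p) *m B *m sqrtmx (hess H p)) 0 0 = G' (p 0 0) * B 0 0.
Proof.
have [E _] := sqrtmx1 p; rewrite -hessE -row1E -E !mxE !big_ord1 !mxE big_ord1; ring.
Qed.

Theorem one_dimensional_case (C : R) (u : V * R -> R) (t : R) : 0 < C ->
  BUC (@closed_half R 1) u -> viscosity_solution H u ->
  viscosity_mxge (fun p => sqrtmx (hess H p)) (fun x => u (x, 0)) C ->
  0 < t -> 0 < 1 - C * t ->
  viscosity_mxge (fun p => sqrtmx (hess H p)) (fun x => u (x, t)) (C / (1 - C * t)).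
Proof.
move=> C0 Bu Hu Hv t0 Ct0.
have [[M M0 HM] _] := BUC_bounds Bu.
have [Hge Hle] := solution_sup_convolution th0 HSC (Ck_continuous CH) Bu Hu t0.
pose u0 s := u (pt s, 0); pose ut s := u (pt s, t).
have Hge1 x y : u0 y - t * L ((y - x) / t) <= ut x.
  by have := Hge (pt x) (pt y); rewrite -pt_sub pt_scale [t^-1 * _]mulrC.
have Hle1 x c : c < ut x -> exists y, c < u0 y - t * L ((y - x) / t).
  move=> /Hle[y Hy]; exists (y 0 0); move: Hy.
  by rewrite {1 2}(row1E y) -pt_sub pt_scale [t^-1 * _]mulrC.
have T0 : touch_bound1 G' u0 C.
  move=> z p b [r r0 Hr].
  have := viscosity_mxge_local (z := pt z) (p := pt p) (B := const_mx b) (M0 := M) Hv _ _ _ (pt 1).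
  rewrite qform1 sqrtmx_conj dot1 !mxE expr1n !mulr1; apply.
  - by move=> x; have := HM (x, 0) (lexx 0); rewrite ler_norml => /andP[].
  - by apply/matrixP => i j; rewrite !mxE.
  exists r => // x; rewrite (row1E x) -pt_sub normr_pt => /Hr.
  rewrite dot1 qform1 !mxE /u0; congr (_ <= _); ring.
have T1 := touch_above_cones L_continuous G_surj hess_gt0 L_lower C0
  (continuous_pt (continuous_u0 Bu)) T0.
have T2 := touch_evolution L_convex L_sub hess_gt0 L_upper t0 C0 Ct0 Hge1 Hle1 T1.
move=> phi x0 sphi Hphi y; rewrite qform_scalar qformN mulNr lerN2 qform1 sqrtmx_conj.
rewrite dot1 -expr2 ler_wpM2r ?sqr_ge0//.
have -> : grad phi x0 0 0 = 'D_(pt 1) phi x0 by rewrite mxE pt1.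
have -> : hess phi x0 0 0 = 'D_(pt 1) ('D_(pt 1) phi) x0 by rewrite mxE pt1.
set P := 'D_(pt 1) phi x0; set D := 'D_(pt 1) _ x0.
have g0 := hess_gt0 P.
apply/ler_addgt0Pr => e e0.
have e1 : 0 < e / G' P by rewrite divr_gt0.
have [r r0 Hr] := taylor2_local x0 (pt 1) (sphi 2%N) e1.
have : G' P * (D - e / G' P) <= C / (1 - C * t).
  apply: (T2 (x0 0 0) P); exists r => // x xr.
  have := Hr _ xr; rewrite pt_scale mulr1 -/P -/D.
  have -> : x0 + pt (x - x0 0 0) = pt x.
    by rewrite {1}(row1E x0) -pt_add addrC subrK.
  have := Hphi (pt x); rewrite /ut -row1E; lra.
rewrite mulrBr mulrCA divff ?gt_eqF// mulr1; lra.
Qed.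

End Line.

(** * Time reversal and the theorem *)

Section Reflection.
Context {R : realType}.

Lemma derive_reflect (V : normedModType R) (f : V -> R) v x :
  'D_v (fun x => f (- x)) x = 'D_(- v) f (- x).
Proof.
rewrite /derive (_ : (fun h : R => h^-1 *: (((fun x => f (- x)) \o shift x) (h *: v)
    - f (- x))) = (fun h => h^-1 *: ((f \o shift (- x)) (h *: - v) - f (- x))))//.
by apply/funext => h /=; rewrite opprD scalerN.
Qed.

Lemma derivable_reflect (V : normedModType R) (f : V -> R) v x :
  derivable f (- x) (- v) -> derivable (fun x => f (- x)) x v.
Proof.
rewrite /derivable (_ : (fun h => h^-1 *: (((fun x => f (- x)) \o shift x) (h *: v)
    - f (- x))) = (fun h => h^-1 *: ((f \o shift (- x)) (h *: - v) - f (- x))))//.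
by apply/funext => h /=; rewrite opprD scalerN.
Qed.

Lemma Ck_reflect (V : normedModType R) k (f : V -> R) :
  Ck_on setT k f -> Ck_on setT k (fun x => f (- x)).
Proof.
have cr (g : V -> R) x : {for - x, continuous g} -> {for x, continuous (fun x => g (- x))}.
  move=> /continuous_atP cg; apply/continuous_atP => e /cg[r r0 Hr].
  by exists r => // w wx; apply: Hr; rewrite -opprD normrN.
elim: k f => [|k IH] f [cf df].
  by split=> // x _; apply: cr; exact: cf.
split=> [x _|v]; first by apply: cr; exact: cf.
have [d1 c1] := df (- v); split=> [x _|].
  by apply: derivable_reflect; exact: d1.
have -> : (fun x => 'D_v (fun x => f (- x)) x) = (fun x => 'D_(- v) f (- x)).
  by apply/funext => x; exact: derive_reflect.
exact: (IH ('D_(- v) f) c1).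
Qed.

Lemma Ck_opp (V : normedModType R) (D : set V) (f : V -> R) : open D ->
  Ck_on D 1 f -> Ck_on D 1 (fun x => - f x).
Proof.
move=> oD [cf df]; split=> [x Dx|v]; first exact: (continuousN (cf x Dx)).
have [d1 [c1 _]] := df v; split=> [x Dx|]; first exact: (derivableN (d1 x Dx)).
split=> [x Dx|]; last exact: I.
apply/continuous_atP => e e0.
have [r r0 Hr] := (continuous_atP _ _).1 (c1 x Dx) _ e0.
have [s s0 Hs] := (near_normP x D).1 (open_nbhs_nbhs (conj oD Dx)).
exists (Num.min r s); first by rewrite lt_min r0.
move=> w; rewrite lt_min => /andP[wr ws].
rewrite (deriveN (d1 w (Hs _ ws))) (deriveN (d1 x Dx)) -opprD normrN; exact: Hr.
Qed.

Lemma smooth_opp (V : normedModType R) (f : V -> R) :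
  smooth f -> smooth (fun x => - f x).
Proof.
move=> sf; rewrite (_ : (fun _ => _) = (fun x => -1 * f x)).
  by apply: smooth_mul => //; exact: smooth_cst.
by apply/funext => x; rewrite mulN1r.
Qed.

Variable d : nat.
Local Notation V := 'rV[R]_d.

Lemma grad_opp (f : V -> R) x : smooth f -> grad (fun x => - f x) x = - grad f x.
Proof.
move=> sf; apply/rowP => j; rewrite !mxE.
exact: (deriveN (Ck_on_derivable (sf 1%N) _)).
Qed.

Lemma hess_opp (f : V -> R) x : smooth f -> hess (fun x => - f x) x = - hess f x.
Proof.
move=> sf; apply/matrixP => i j; rewrite !mxE.
have -> : (fun y => 'D_(delta_mx 0 j) (fun x => - f x) y) = - 'D_(delta_mx 0 j) f.
  by apply/funext => y; exact: (deriveN (Ck_on_derivable (sf 1%N) _)).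
exact: (deriveN (Ck_on_derivable (Ck_on_derive _ (sf 2%N)) _)).
Qed.

Lemma derive_oppv (f : V -> R) v x : Ck_on setT 1 f -> 'D_(- v) f x = - 'D_v f x.
Proof. by move=> Cf; rewrite -scaleN1r (deriveZ_C1 _ _ Cf)// mulN1r. Qed.

Lemma hess_reflect (H : V -> R) p : Ck_on setT 2 H ->
  hess (fun p => H (- p)) p = hess H (- p).
Proof.
move=> CH; apply/matrixP => i j.
pose ei : V := delta_mx 0 i; pose ej : V := delta_mx 0 j.
have hE f q : hess f q i j = 'D_ei (fun y => 'D_ej f y) q by rewrite mxE.
transitivity ('D_ei (fun y => 'D_ej (fun p => H (- p)) y) p); first exact: hE.
transitivity ('D_ei ('D_ej H) (- p)); last by rewrite hE.
have -> : (fun y => 'D_ej (fun p => H (- p)) y) = (fun y => - 'D_ej H (- y)).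
  apply/funext => y; rewrite derive_reflect; exact: derive_oppv (Ck_on_C1 CH).
have Cj : Ck_on setT 1 ('D_ej H) by exact: Ck_on_derive.
have := @deriveN _ _ _ (fun y => 'D_ej H (- y)) p ei.
move=> ->; last by apply: (@derivable_reflect _ ('D_ej H)); exact: (Ck_on_derivable Cj).
by rewrite (@derive_reflect _ ('D_ej H)) derive_oppv// opprK.
Qed.

Lemma BUC_opp (u : V * R -> R) : BUC (@closed_half R d) u ->
  BUC (@closed_half R d) (fun z => - u z).
Proof.
move=> [bu cu]; split.
  by move: bu; rewrite /bounded_near; apply: filterS => M HM z /HM /=; rewrite normrN.
apply/unif_continuousP => e e0; have [r r0 Hr] := (unif_continuousP _).1 cu e e0.
exists r => // x /Hr; rewrite -!ball_normE /= => A.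
by rewrite -opprD normrN.
Qed.

Lemma space_grad_opp (phi : V * R -> R) z : Ck_on (@open_half R d) 1 phi ->
  0 < z.2 -> space_grad (fun z => - phi z) z = - space_grad phi z.
Proof.
case: z => x t Cphi t0; apply/rowP => j; rewrite !mxE /=.
rewrite -(derive_fst (fun z => - phi z)) -(derive_fst phi).
exact: (deriveN (Ck_on_derivable Cphi t0)).
Qed.

Lemma time_deriv_opp (phi : V * R -> R) z : Ck_on (@open_half R d) 1 phi ->
  0 < z.2 -> time_deriv (fun z => - phi z) z = - time_deriv phi z.
Proof.
case: z => x t Cphi t0; rewrite /time_deriv !derive1E /=.
rewrite -(derive_snd (fun z => - phi z)) -(derive_snd phi).
exact: (deriveN (Ck_on_derivable Cphi t0)).
Qed.

(** The sign change exchanges subsolutions and supersolutions, since it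
    exchanges contact from above and from below. *)
Lemma viscosity_solution_opp (H : V -> R) (u : V * R -> R) :
  viscosity_solution (fun p => - H p) u ->
  viscosity_solution (fun p => H (- p)) (fun z => - u z).
Proof.
move=> [sub sup]; split=> phi z Cphi z0 Hphi;
    have CN := Ck_opp (@open_open_half R d) Cphi.
  have := sup (fun z => - phi z) z CN z0.
  rewrite space_grad_opp// time_deriv_opp//= lerN2; apply.
  by apply: filterS Hphi => w; lra.
have := sub (fun z => - phi z) z CN z0.
rewrite space_grad_opp// time_deriv_opp//= lerN2; apply.
by apply: filterS Hphi => w; lra.
Qed.

Lemma viscosity_mxge_opp (F : V -> 'M[R]_d) (v : V -> R) C :
  viscosity_mxle F v C -> viscosity_mxge (fun p => F (- p)) (fun x => - v x) C.
Proof.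
move=> Hv phi x0 sphi Hphi y.
have Hphi' x : v x - - phi x <= v x0 - - phi x0 by have := Hphi x; lra.
have := Hv (fun x => - phi x) x0 (smooth_opp sphi) Hphi' y.
rewrite grad_opp// hess_opp// mulmxN mulNmx !qform_scalar !qformN; lra.
Qed.

Lemma viscosity_mxle_opp (F : V -> 'M[R]_d) (v : V -> R) C :
  viscosity_mxge (fun p => F (- p)) (fun x => - v x) C -> viscosity_mxle F v C.
Proof.
move=> Hv phi x0 sphi Hphi y.
have Hphi' x : - v x0 - - phi x0 <= - v x - - phi x by have := Hphi x; lra.
have := Hv (fun x => - phi x) x0 (smooth_opp sphi) Hphi' y.
rewrite grad_opp// hess_opp// opprK mulmxN mulNmx !qform_scalar !qformN; lra.
Qed.

End Reflection.

Lemma semiconcavity_preserved (R : realType) (d : nat) (H : 'rV[R]_d -> R) (C : R)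
    (u : 'rV[R]_d * R -> R) (t : R) :
  Ck_on setT 2 H -> uniformly_convex H -> d = 1%N \/ quadratic H -> 0 < C ->
  BUC (@closed_half R d) u -> viscosity_solution H u ->
  viscosity_mxge (fun p => sqrtmx (hess H p)) (fun x => u (x, 0)) C ->
  0 < t -> 0 < 1 - C * t ->
  viscosity_mxge (fun p => sqrtmx (hess H p)) (fun x => u (x, t)) (C / (1 - C * t)).
Proof.
move=> CH cvH [d1|qH]; last exact: quadratic_case.
subst d; have [th th0 HSC] := uniformly_convex_strongly CH cvH.
exact: (one_dimensional_case CH th0 HSC).
Qed.

Theorem theorem1p2 (R : realType) (d : nat) (hd : (0 < d)%N)
    (H : 'rV[R]_d -> R) (C : R)
    (HC2 : Ck_on setT 2 H) (Hconv : uniformly_convex H)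
    (Hcase : d = 1%N \/ quadratic H) (C_gt0 : 0 < C) :
  let F := fun p : 'rV[R]_d => sqrtmx (hess H p) in
  (forall u : 'rV[R]_d * R -> R,
     BUC (@closed_half R d) u ->
     viscosity_solution H u ->
     viscosity_mxge F (fun x => u (x, 0)) C ->
     forall t : R, 0 < t -> 0 < Num.max (1 - C * t) 0 ->
       viscosity_mxge F (fun x => u (x, t)) (C / Num.max (1 - C * t) 0))
  /\
  (forall u : 'rV[R]_d * R -> R,
     BUC (@closed_half R d) u ->
     viscosity_solution (fun p => - H p) u ->
     viscosity_mxle F (fun x => u (x, 0)) C ->
     forall t : R, 0 < t -> 0 < Num.max (1 - C * t) 0 ->
       viscosity_mxle F (fun x => u (x, t)) (C / Num.max (1 - C * t) 0)).
Proof.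
move=> F.
have maxE t : 0 < Num.max (1 - C * t) 0 ->
    0 < 1 - C * t /\ Num.max (1 - C * t) 0 = 1 - C * t.
  by rewrite lt_max ltxx orbF => Ct; split => //; rewrite max_l// ltW.
split=> u Bu Hu Hv t t0 /maxE[Ct ->]; first exact: semiconcavity_preserved.
pose Hr p := H (- p).
have CHr : Ck_on setT 2 Hr by exact: Ck_reflect.
have hHr p : hess Hr p = hess H (- p) by exact: hess_reflect.
have FE : (fun p => F (- p)) = (fun p => sqrtmx (hess Hr p)).
  by apply/funext => p; rewrite hHr.
have cvHr : uniformly_convex Hr.
  have [th [Th [th0 Th0 HT]]] := Hconv; exists th, Th.
  by split; [exact: th0|exact: Th0|move=> p; rewrite hHr; exact: HT].
have caseHr : d = 1%N \/ quadratic Hr.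
  have [d1|[A [At Ab HA]]] := Hcase; first by left.
  right; exists A; split; [exact: At|exact: Ab|move=> p].
  by rewrite /Hr HA -scaleN1r qformZ sqrrN expr1n mul1r.
have Hv' := viscosity_mxge_opp Hv; rewrite FE in Hv'.
apply: viscosity_mxle_opp; rewrite FE.
exact: (@semiconcavity_preserved R d Hr C (fun z => - u z) t CHr cvHr caseHr C_gt0
  (BUC_opp Bu) (viscosity_solution_opp Hu) Hv' t0 Ct).
Qed.
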